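(* For a finite graph $G$ the following are equivalent: (i) $G$ is a mirror graph; (ii) $G$ is (isomorphic to) the Cayley graph of a finite Coxeter group with respect to its Coxeter generating set; (iii) $G$ is the tope graph of a reflection arrangement.
   Context: A mirror graph is a finite connected simple graph $G$ admitting a partition $\{E_1,\dots,E_k\}$ of its edges such that for every $i$ there is an automorphism $\alpha_i$ of $G$ with (a) $\alpha_i(u)=v$, $\alpha_i(v)=u$ for every edge $uv\in E_i$, and (b) $G-E_i$ has exactly two connected components $G_i^1,G_i^2$ and $\alpha_i$ maps $G_i^1$ isomorphically onto $G_i^2$. A Coxeter group is a group with presentation $\langle \alpha_1,\dots,\alpha_m\mid (\alpha_i\alpha_j)^{k_{ij}}=1\ \text{for all } i,j\rangle$ with $k_{ii}=1$ and $k_{ij}\ge 2$ (possibly $\infty$, meaning no relation) for $i\ne j$; its Cayley graph $\mathrm{Cay}(A,S)$ with $S=\{\alpha_1,\dots,\alpha_m\}$ has vertex set $A$, with $\beta_1,\beta_2$ adjacent iff $\beta_1=\alpha_i\beta_2$ for some $i$. A reflection arrangement is a finite set of pairwise distinct linear hyperplanes $H_1,\dots,H_m$ in $\mathbb R^n$ (all through the origin) such that for each $i$ the orthogonal reflection $\sigma_{H_i}(x)=x-2\frac{x\cdot v_i}{v_i\cdot v_i}v_i$ ($v_i$ a normal vector of $H_i$) permutes $\{H_1,\dots,H_m\}$. Its tope graph has as vertices the chambers (connected components of $\mathbb R^n\setminus\bigcup H_i$), two chambers being adjacent iff they are separated by exactly one hyperplane. *)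

(* Defs.v *)
From Stdlib Require Import Reals.
From mathcomp Require Import all_boot all_fingroup.
Set Implicit Arguments.
Unset Strict Implicit.
Unset Printing Implicit Defensive.

Definition simple_graph (T : finType) (e : rel T) : Prop :=
  (forall x y, e x y = e y x) /\ (forall x, ~~ e x x).

Definition graph_connected (T : finType) (e : rel T) : Prop :=
  (exists x : T, True) /\ (forall x y, connect e x y).

Definition graph_iso (T U : finType) (e : rel T) (r : rel U) : Prop :=
  exists f : T -> U, bijective f /\ (forall x y, r (f x) (f y) = e x y).

Definition is_automorphism (T : finType) (e : rel T) (a : {perm T}) : Prop :=
  forall x y, e (a x) (a y) = e x y.

(* ---------- Mirror graphs ----------
   The edge partition {E_1,...,E_k} is an indexed family of symmetric
   relations, each contained in e, such that every edge lies in exactly one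
   E_i.  G - E_i is the graph with relation [rel x y | e x y && ~~ E i x y]. *)
Definition mirror_graph (T : finType) (e : rel T) : Prop :=
  graph_connected e /\
  exists (k : nat) (E : 'I_k -> rel T),
    (forall i x y, E i x y -> e x y) /\
    (forall i x y, E i x y = E i y x) /\
    (forall x y, e x y -> exists! i, E i x y) /\
    forall i, exists a : {perm T},
      is_automorphism e a /\
      (forall u v, E i u v -> a u = v /\ a v = u) /\
      let e' := [rel x y | e x y && ~~ E i x y] in
      exists u v : T,
        ~~ connect e' u v /\
        (forall w, connect e' u w || connect e' v w) /\
        (forall w, connect e' v w <-> exists x, connect e' u x /\ a x = w) /\
        (forall x y, connect e' u x -> connect e' u y -> e' (a x) (a y) = e' x y).

(* ---------- Coxeter groups ----------
   Abstract (possibly infinite) groups, used to express the universal property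
   of a group presentation. *)
Record group_str := GroupStr {
  gcar :> Type;
  gmul : gcar -> gcar -> gcar;
  gone : gcar;
  ginv : gcar -> gcar;
  gmulA : forall x y z, gmul x (gmul y z) = gmul (gmul x y) z;
  gmul1 : forall x, gmul gone x = x;
  gmulV : forall x, gmul (ginv x) x = gone
}.

Fixpoint gpow (H : group_str) (x : H) (n : nat) : H :=
  match n with 0 => gone H | n'.+1 => gmul x (gpow x n') end.

(* (gT, a) is a Coxeter system with Coxeter matrix k (None = infinity):
   the finite group gT (taken as a whole) is presented by generators a_i and
   relations (a_i a_j)^(k i j) = 1, expressed via generation + relations +
   the universal property of the presented group. *)
Definition coxeter_system (gT : finGroupType) (m : nat) (a : 'I_m -> gT)
    (k : 'I_m -> 'I_m -> option nat) : Prop :=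
  (forall i, k i i = Some 1) /\
  (forall i j, i != j -> match k i j with Some n => 2 <= n | None => true end) /\
  (<< [set a i | i : 'I_m] >>%g = [set: gT]) /\
  (forall i j n, k i j = Some n -> ((a i * a j) ^+ n = 1)%g) /\
  (forall (H : group_str) (h : 'I_m -> H),
     (forall i j n, k i j = Some n -> gpow (gmul (h i) (h j)) n = gone H) ->
     exists f : gT -> H,
       (forall x y, f (x * y)%g = gmul (f x) (f y)) /\ (forall i, f (a i) = h i)).

Definition cayley_rel (gT : finGroupType) (m : nat) (a : 'I_m -> gT) : rel gT :=
  fun x y => [exists i : 'I_m, x == (a i * y)%g].

Definition coxeter_cayley_graph (T : finType) (e : rel T) : Prop :=
  exists (gT : finGroupType) (m : nat) (a : 'I_m -> gT)
         (k : 'I_m -> 'I_m -> option nat),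
    coxeter_system a k /\ graph_iso e (cayley_rel a).

Local Open Scope R_scope.
Definition point (n : nat) := 'I_n -> R.

Definition dot (n : nat) (x y : point n) : R :=
  \big[Rplus/R0]_(c : 'I_n) (x c * y c).

Definition hyperplane (n : nat) (v : point n) : point n -> Prop :=
  fun x => dot v x = R0.

Definition reflect_in (n : nat) (v x : point n) : point n :=
  fun c => (x c - 2 * (dot x v / dot v v) * v c).

Definition reflection_arrangement (n m : nat) (v : 'I_m -> point n) : Prop :=
  (forall i, exists c, v i c <> R0) /\
  (forall i j, (forall x, hyperplane (v i) x <-> hyperplane (v j) x) -> i = j) /\
  (forall i j, exists l, forall x,
     hyperplane (v l) x <->
     exists y, hyperplane (v j) y /\ forall c, x c = reflect_in (v i) y c).

Definition dist2 (n : nat) (x y : point n) : R :=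
  \big[Rplus/R0]_(c : 'I_n) ((x c - y c) * (x c - y c)).

Definition open_set (n : nat) (O : point n -> Prop) : Prop :=
  forall x, O x -> exists eps, (0 < eps) /\ forall y, (dist2 x y < eps) -> O y.

Definition connected_set (n : nat) (C : point n -> Prop) : Prop :=
  forall O1 O2 : point n -> Prop, open_set O1 -> open_set O2 ->
    (forall z, C z -> O1 z \/ O2 z) ->
    (forall z, ~ (C z /\ O1 z /\ O2 z)) ->
    (forall z, C z -> O1 z) \/ (forall z, C z -> O2 z).

Definition same_component (n : nat) (U : point n -> Prop) (x y : point n) : Prop :=
  exists C : point n -> Prop,
    (forall z, C z -> U z) /\ connected_set C /\ C x /\ C y.

Definition separates (n : nat) (v : point n) (C D : point n -> Prop) : Prop :=
  ((forall x, C x -> (0 < dot v x)) /\ (forall y, D y -> (dot v y < 0))) \/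
  ((forall x, C x -> (dot v x < 0)) /\ (forall y, D y -> (0 < dot v y))).

(* (T,e) is (isomorphic to) the tope graph of a reflection arrangement:
   f picks a point in each chamber, bijectively onto the set of chambers
   (= connected components of the complement of the union of hyperplanes). *)
Definition tope_graph_of_reflection_arrangement (T : finType) (e : rel T) : Prop :=
  exists (n m : nat) (v : 'I_m -> point n),
    reflection_arrangement v /\
    let U := fun x : point n => forall i, ~ hyperplane (v i) x in
    let chamber := fun t (f : T -> point n) => same_component U (f t) in
    exists f : T -> point n,
      (forall t, U (f t)) /\
      (forall x, U x -> exists! t, same_component U (f t) x) /\
      (forall t t', e t t' <->
         exists i, separates (v i) (chamber t f) (chamber t' f) /\
           forall j, separates (v j) (chamber t f) (chamber t' f) -> j = i).

(* Main.v *)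
(* The proof goes around the cycle (i) => (ii) => (iii) => (i).

   (i) => (ii).  Crossing E_i changes exactly the side of E_i, and folding a
   path along a mirror shortens it, so the distance of two vertices is the
   number of classes ("walls") separating them and every automorphism permutes
   the walls.  Two mirrors at a vertex span an even cycle on which each of
   their walls is crossed at two opposite edges.  Consequently an automorphism
   fixing the ends of all edges of one wall fixes the neighbours of those ends,
   and then everything; so a wall has only one mirror, deletion of letters
   works, and the mirrors at a base vertex generate a group acting simply
   transitively.  If two of them both separate z from the base vertex, the
   antipode in their cycle lies on a geodesic to z; this drives Matsumoto's
   induction, which gives the universal property of the presentation.

   (ii) => (iii).  In the reflection representation rho of Tits on R^S, each
   w alpha_s is a nonnegative or a nonpositive combination of simple roots,
   according to whether l(ws) > l(w) or not.  The map
   x |-> (coordinates of rho(w) x)_w carries it equivariantly and isometrically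
   for an invariant inner product into R^(W x S).  There the indicator vector
   of the block w pairs with a root b to the coordinate sum of rho(w) b, which
   provides a point of the chamber of w without solving any linear system.

   (iii) => (i).  A segment between two chambers, with generic endpoint,
   crosses the separating hyperplanes one at a time, without leaving the common
   half-spaces; near the crossing point of an edge the reflection in its wall
   exchanges the two adjacent chambers. *)
Require Import Defs.
From Stdlib Require Import Reals FunctionalExtensionality.
From mathcomp Require Import all_boot all_fingroup all_order all_algebra cyclic.
From mathcomp Require Import ring lra reals Rstruct.
Set Implicit Arguments.
Unset Strict Implicit.
Unset Printing Implicit Defensive.
Import Order.TTheory GRing.Theory Num.Theory.

(** * Mirror graphs are Coxeter Cayley graphs *)

Fixpoint alt_word (I : Type) (i j : I) (n : nat) : seq I :=
  if n is n'.+1 then i :: alt_word j i n' else [::].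

Lemma size_alt_word (I : Type) (i j : I) n : size (alt_word i j n) = n.
Proof. by elim: n i j => //= n IH i j; rewrite IH. Qed.

Lemma alt_wordS (I : Type) (i j : I) n :
  alt_word i j n.+1 = rcons (alt_word i j n) (if odd n then j else i).
Proof.
elim: n i j => // n IH i j.
by rewrite [LHS]/= -/(alt_word j i n.+1) IH /=; case: (odd n).
Qed.

Lemma alt_word_add (I : Type) (i j : I) n p :
  alt_word i j (n + p) =
  alt_word i j n ++ (if odd n then alt_word j i p else alt_word i j p).
Proof.
elim: n i j => // n IH i j; rewrite addSn /= IH.
by case: (odd n).
Qed.

(** * Evaluation of words in an abstract group *)

Section GroupStr.
Variable H : group_str.
Implicit Types x y z : H.

Lemma gmulVr x : gmul x (ginv x) = gone H.
Proof. by rewrite -(gmul1 (gmul x _)) -{1}(gmulV (ginv x)) -gmulA (gmulA _ x) gmulV gmul1 gmulV. Qed.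

Lemma gmul1r x : gmul x (gone H) = x.
Proof. by rewrite -(gmulV x) gmulA gmulVr gmul1. Qed.

Lemma gpowSr x n : gpow x n.+1 = gmul (gpow x n) x.
Proof.
elim: n => [|n IH]; first by rewrite /= gmul1 gmul1r.
by rewrite -[LHS]/(gmul x (gpow x n.+1)) {1}IH gmulA.
Qed.

Variables (I : eqType) (h : I -> H).
(** The head of a word is the rightmost factor, in agreement with permutation products, whose
    rightmost factor is applied last. *)
Definition gev (q : seq I) : H := foldr (fun i g => gmul g (h i)) (gone H) q.

Lemma gev_cat p q : gev (p ++ q) = gmul (gev q) (gev p).
Proof. by elim: p => [|i p IH] /=; rewrite ?gmul1r // IH gmulA. Qed.

Lemma gev_alt2 i j n : gev (alt_word i j n.*2) = gpow (gmul (h j) (h i)) n.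
Proof. by elim: n => // n IH; rewrite gpowSr -IH gmulA. Qed.

(** Each generator is its own inverse, so the letters of the relator can be carried to the other
    side one at a time. The case [p = q = n] is the braid relation. *)
Lemma gev_antipode i j n p q : gmul (h i) (h i) = gone H -> gmul (h j) (h j) = gone H ->
  gev (alt_word i j n.*2) = gone H -> gev (alt_word j i n.*2) = gone H ->
  p + q = n.*2 -> gev (alt_word i j p) = gev (alt_word j i q).
Proof.
elim: q p i j => [|q IH] p i j hi hj hn hn'; first by rewrite addn0 => ->.
rewrite addnS -addSn => /(IH _ j i hj hi hn' hn) /= <-.
by rewrite -gmulA hj gmul1r.
Qed.
End GroupStr.

(** * Walls, folding and distance *)

Section MirrorSystem.
Variables (T W : finType) (e : rel T).
Variables (side : W -> T -> bool) (r : W -> {perm T}).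
Hypothesis e_sym : symmetric e.
Hypothesis e_conn : forall x y, connect e x y.

(** A class of edges is encoded by a two-colouring [side i] of the vertices: it consists of the
    edges whose ends differ in colour, and [cut i] extends this relation to all pairs of
    vertices. *)
Definition cut i x y := side i x != side i y.

Definition mirror_of i (a : {perm T}) :=
  is_automorphism e a /\ forall x y, e x y -> cut i x y -> a x = y.

Hypothesis edge_wall : forall x y, e x y ->
  exists2 i, cut i x y & forall j, cut j x y -> j = i.
Hypothesis r_mirror : forall i, mirror_of i (r i).
Hypothesis r_inv : forall i, involutive (r i).

Lemma cut_sym i x y : cut i x y = cut i y x.
Proof. by rewrite /cut eq_sym. Qed.

Lemma cut_xor i x y z : cut i y z = (cut i x y != cut i x z).
Proof. by rewrite /cut; case: (side i x); case: (side i y); case: (side i z). Qed.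

Lemma cut_uniq x y i j : e x y -> cut i x y -> cut j x y -> i = j.
Proof. by move=> /edge_wall[l _ Hl] /Hl-> /Hl. Qed.

(** The part of the path before its first crossing of the wall is replaced by its mirror image; the
    crossing edge then collapses, since [a] sends its first end to its second. *)
Lemma fold_path i a y q : mirror_of i a -> path e y q -> cut i y (last y q) ->
  exists q', [/\ path e (a y) q', last (a y) q' = last y q & (size q').+1 = size q].
Proof.
move=> [a_aut a_edge]; elim: q y => [|w q IH] y /=; first by rewrite /cut eqxx.
case/andP=> eyw pq c.
have [cyw|ncyw] := boolP (cut i y w); first by exists q; rewrite (a_edge _ _ eyw cyw).
have cw : cut i w (last w q) by rewrite (cut_xor _ y) c (negbTE ncyw).
have [q' [pq' lq' sq']] := IH _ pq cw.
by exists (a w :: q'); rewrite /= a_aut eyw pq' lq' sq'.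
Qed.

(** This turns out to be the graph distance: [walldist_path] bounds every path from below, and
    [geodesic] attains the bound. *)
Definition walldist x z := #|[set i | cut i x z]|.

Lemma walldistxx x : walldist x x = 0.
Proof. by apply/eqP; rewrite cards_eq0 -subset0; apply/subsetP => i; rewrite inE /cut eqxx. Qed.

Lemma walldist_edge i x y z : e x y -> cut i x y -> cut i x z ->
  walldist x z = (walldist y z).+1.
Proof.
move=> exy cxy cxz; rewrite /walldist.
have -> : [set j | cut j x z] = i |: [set j | cut j y z].
  apply/setP => j; rewrite !inE (cut_xor j x y).
  have [->|nji] := eqVneq j i; first by rewrite cxz.
  case cj: (cut j x y) => /=; last by case: (cut j x z).
  by rewrite (cut_uniq exy cxy cj) eqxx in nji.
by rewrite cardsU1 inE (cut_xor i x) cxy cxz.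
Qed.

Lemma walldist_path x q : path e x q -> walldist x (last x q) <= size q.
Proof.
elim: q x => [|y q IH] x /=; first by rewrite walldistxx.
case/andP=> exy /IH le; have [i cxy _] := edge_wall exy.
have [c|nc] := boolP (cut i x (last y q)); first by rewrite (walldist_edge exy cxy c).
move: le; rewrite (@walldist_edge i y x) 1?e_sym // => [/ltnW/leqW //||].
  by rewrite cut_sym.
by rewrite (cut_xor i x) cxy (negbTE nc).
Qed.

(** Any path is shortened from its end backwards. If the wall of the new first edge separates [x]
    from the target, that edge is prepended; otherwise it separates [y] from the target, and folding
    the path already built makes it start at [r i y = x]. *)
Lemma geodesic x z : exists q, [/\ path e x q, last x q = z & size q = walldist x z].
Proof.
have /connectP[p pp ->] := e_conn x z; elim: p x pp => [|y p IH] x /=.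
  by exists [::]; rewrite walldistxx.
case/andP=> exy /IH[q [pq lq sq]]; have [i cxy _] := edge_wall exy.
have [c|nc] := boolP (cut i x (last y p)).
  by exists (y :: q); rewrite /= exy pq lq sq (walldist_edge exy cxy c).
have cy : cut i y (last y p) by rewrite (cut_xor i x) cxy (negbTE nc).
have eyx : e y x by rewrite e_sym.
have cyx : cut i y x by rewrite cut_sym.
rewrite -lq in cy; have [q' [pq' lq' sq']] := fold_path (r_mirror i) pq cy.
have ry : r i y = x by apply: (r_mirror i).2.
exists q'; rewrite -ry; split => //; first by rewrite lq'.
by apply/eqP; rewrite ry -eqSS sq' sq -lq (walldist_edge eyx cyx cy).
Qed.

Lemma walldist_eq0 x z : walldist x z = 0 -> x = z.
Proof. by have [q [_ <- <-]] := geodesic x z => /size0nil->. Qed.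

Lemma walldist_reflect i a x z : mirror_of i a -> cut i x z ->
  walldist (a x) z < walldist x z.
Proof.
move=> ma c; have [q [pq lq <-]] := geodesic x z.
rewrite -lq in c; have [q' [pq' lq' <-]] := fold_path ma pq c.
by rewrite ltnS -lq -lq'; apply: walldist_path.
Qed.

Lemma automorphismV (g : {perm T}) : is_automorphism e g -> is_automorphism e g^-1%g.
Proof. by move=> ag x y; rewrite -[LHS]ag !permKV. Qed.

Lemma automorphismM (g h : {perm T}) :
  is_automorphism e g -> is_automorphism e h -> is_automorphism e (g * h)%g.
Proof. by move=> ag ah x y; rewrite !permM ah ag. Qed.

Lemma walldist_aut (g : {perm T}) x z : is_automorphism e g ->
  walldist (g x) (g z) = walldist x z.
Proof.
have le (h : {perm T}) u v : is_automorphism e h -> walldist (h u) (h v) <= walldist u v.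
  move=> ah; have [q [pq <- <-]] := geodesic u v.
  rewrite -last_map -(size_map h); apply: walldist_path.
  by rewrite path_map (eq_path (e' := e)).
move=> ag; apply/eqP; rewrite eqn_leq le //=.
by rewrite -{1}(permK g x) -{1}(permK g z) le //; apply: automorphismV.
Qed.

(** The side of [z] is read off from which end of a crossing edge is nearer to [z]. Walls are thus
    determined by the metric, so that automorphisms carry walls to walls. *)
Lemma cut_dist i x y z : e x y -> cut i x y -> cut i x z = (walldist y z < walldist x z).
Proof.
move=> exy cxy; have [c|nc] := boolP (cut i x z); first by rewrite (walldist_edge exy cxy c) ltnSn.
have -> : walldist y z = (walldist x z).+1.
  by apply: (@walldist_edge i); rewrite 1?e_sym 1?cut_sym // (cut_xor i x) cut_sym ?cxy 1?cut_sym (negbTE nc).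
by rewrite ltnNge leqnSn.
Qed.

Lemma cut_aut (g : {perm T}) i j x y u v : is_automorphism e g -> e x y -> cut i x y ->
  cut j (g x) (g y) -> cut j (g u) (g v) = cut i u v.
Proof.
move=> ag exy ci cj; rewrite (cut_xor j (g x)) (cut_xor i x).
have egxy : e (g x) (g y) by rewrite ag.
by rewrite !(cut_dist _ egxy cj) !(cut_dist _ exy ci) !walldist_aut.
Qed.

Lemma mirror_conj (g a : {perm T}) i j x y : is_automorphism e g -> e x y -> cut i x y ->
  cut j (g x) (g y) -> mirror_of i a -> mirror_of j (a ^ g)%g.
Proof.
move=> ag exy ci cj [aa ea]; split.
  by rewrite /conjg; do 2?apply: automorphismM => //; apply: automorphismV.
move=> u v; rewrite -(permKV g u) -(permKV g v) ag => euv.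
rewrite (cut_aut _ _ ag exy ci cj) => c.
by rewrite permJ (ea _ _ euv c).
Qed.

(* The head of a word is the letter applied last. *)
Definition ev (q : seq W) : {perm T} := foldr (fun i g => (g * r i)%g) 1%g q.

Lemma ev_cons i q x : ev (i :: q) x = r i (ev q x).
Proof. by rewrite /= permM. Qed.

Lemma ev_altS i j n x : ev (alt_word i j n.+1) x = r i (ev (alt_word j i n) x).
Proof. exact: ev_cons. Qed.

Lemma ev_cat p q : ev (p ++ q) = (ev q * ev p)%g.
Proof. by elim: p => [|i p IH] /=; rewrite ?mulg1 // IH mulgA. Qed.

Lemma r2 i : (r i * r i = 1)%g.
Proof. by apply/permP => x; rewrite permM perm1 r_inv. Qed.

Lemma rV i : ((r i)^-1 = r i)%g.
Proof. by apply: (mulgI (r i)); rewrite mulgV r2. Qed.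

Lemma ev_aut q : is_automorphism e (ev q).
Proof.
elim: q => [|i q IH] /=; first by move=> x y; rewrite !perm1.
by apply: automorphismM => //; case: (r_mirror i).
Qed.

Lemma ev_alt2 i j n : (ev (alt_word i j n.*2) = (r j * r i) ^+ n)%g.
Proof. by elim: n => //= n IH; rewrite IH -mulgA expgSr. Qed.

Lemma ev_alt2C i j n x : ev (alt_word i j n.*2) x = x -> ev (alt_word j i n.*2) x = x.
Proof.
rewrite !ev_alt2 => h.
have -> : (r i * r j = (r j * r i)^-1)%g by rewrite invMg !rV.
by rewrite expgVn -{1}h permK.
Qed.

(** Letters are peeled off the second word and added to the first until the second is empty. The
    starting letter changes at each step, hence the two alternatives. *)
Lemma alt_meet i j p q x : ev (alt_word i j p) x = ev (alt_word j i q) x ->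
  ev (alt_word i j (p + q)) x = x \/ ev (alt_word j i (p + q)) x = x.
Proof.
elim: q p i j => [|q IH] p i j; first by rewrite addn0 /= perm1; left.
rewrite [alt_word j i q.+1]/= ev_cons => h.
have := IH p.+1 j i; rewrite [alt_word j i p.+1]/= ev_cons h r_inv => /(_ erefl).
by rewrite addnS addSn; case; [right|left].
Qed.

(** * Dihedral cycles spanned by two mirrors at a vertex *)

Definition wall_at x i := e x (r i x) && cut i x (r i x).

(** The number [m] is half the length of the alternating closed walk through [x]. It is defined by
    the orbit of [x] alone; [dihedral_order] later identifies it with the order of a product of two
    mirrors. *)
Definition dihedral x i j m :=
  [/\ 0 < m, ev (alt_word i j m.*2) x = x &
      forall n, 0 < n < m -> ev (alt_word i j n.*2) x <> x].

Lemma dihedralC x i j m : dihedral x i j m -> dihedral x j i m.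
Proof. by case=> m0 hm hn; split=> // [|n /hn h /ev_alt2C]; first apply: ev_alt2C. Qed.

Lemma dihedral_ex x i j : exists m, dihedral x i j m.
Proof.
pose P n := (0 < n) && (ev (alt_word i j n.*2) x == x).
have exP : exists n, P n.
  by exists #[r j * r i]%g; rewrite /P order_gt0 ev_alt2 expg_order perm1 /=.
case: (ex_minnP exP) => m /andP[m0 /eqP hm] mini; exists m; split=> // n /andP[n0 nm] /eqP hn.
by move: (mini n); rewrite /P n0 hn leqNgt nm => /(_ isT).
Qed.

(** The word grows at its end, that is, by the letter applied first, so the edge is the image under
    an automorphism of an edge at [x]. *)
Lemma alt_edge x i j n : wall_at x i -> wall_at x j ->
  e (ev (alt_word i j n) x) (ev (alt_word i j n.+1) x).
Proof.
move=> /andP[ei _] /andP[ej _].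
rewrite alt_wordS -cats1 ev_cat permM ev_aut /= mul1g.
by case: (odd n).
Qed.

Lemma alt_antipode x i j m p q : ev (alt_word i j m.*2) x = x -> p + q = m.*2 ->
  ev (alt_word i j p) x = ev (alt_word j i q) x.
Proof.
elim: q p i j => [|q IH] p i j hm; first by rewrite addn0 => ->; rewrite hm perm1.
rewrite addnS -addSn => /(IH _ j i (ev_alt2C hm)).
by rewrite [alt_word j i p.+1]/= [alt_word j i q.+1]/= !ev_cons => <-; rewrite r_inv.
Qed.

Section Dihedral.
Variables (x : T) (i j : W) (m : nat).
Hypotheses (wi : wall_at x i) (wj : wall_at x j) (nij : i != j).
Hypothesis dm : dihedral x i j m.

(** The first edge crosses the wall [i]. If a later one crossed it again, [r i] would exchange its
    ends, and the two alternating paths would meet and close up before [2m] steps. *)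
Lemma dihedral_far p : p < m -> cut i x (ev (alt_word i j p.+1) x).
Proof.
have [m0 hm hn] := dm; have [ei ci] := andP wi.
elim: p => [_|p IH lt]; first by rewrite ev_cons perm1.
have ee := alt_edge p.+1 wi wj.
have nc : ~~ cut i (ev (alt_word i j p.+1) x) (ev (alt_word i j p.+2) x).
  apply/negP => c; have := (r_mirror i).2 _ _ ee c.
  rewrite [alt_word i j p.+1]/= ev_cons r_inv => /esym/alt_meet.
  rewrite addSnnS addnn => h.
  by apply: (hn p.+1) => //; case: h => // /ev_alt2C.
by move: nc; rewrite (cut_xor i x) IH ?(ltnW lt) //; case: (cut i x _).
Qed.

Lemma dihedral_near p : p < m -> ~~ cut i x (ev (alt_word j i p) x).
Proof.
have [m0 hm hn] := dm; have [ei ci] := andP wi.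
elim: p => [_|p IH lt]; first by rewrite /cut perm1 eqxx.
have ee := alt_edge p wj wi.
have nc : ~~ cut i (ev (alt_word j i p) x) (ev (alt_word j i p.+1) x).
  apply/negP => c; have := (r_mirror i).2 _ _ ee c.
  rewrite -ev_cons -[i :: _]/(alt_word i j p.+1) => /alt_meet.
  rewrite addnn => h.
  by apply: (hn p.+1) => //; case: h => // /ev_alt2C.
by move: nc; rewrite (cut_xor i x) (negbTE (IH (ltnW lt))); case: (cut i x _).
Qed.

End Dihedral.

(** The mirror of the wall crossed between steps [n] and [n+1] of the alternating path; as a word it
    is a palindrome of length [2n+1]. *)
Fixpoint alt_mirror i j n : {perm T} :=
  if n is n'.+1 then (alt_mirror j i n' ^ r i)%g else r i.

Lemma alt_mirrorE i j n : alt_mirror i j n = ev (alt_word i j n.*2.+1).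
Proof.
elim: n i j => [|n IH] i j; first by rewrite /= mul1g.
have -> : alt_word i j n.+1.*2.+1 = i :: rcons (alt_word j i n.*2.+1) i.
  by rewrite doubleS [LHS]/= -[j :: _]/(alt_word j i n.*2.+2) alt_wordS /= odd_double.
by rewrite -cats1 [LHS]/= IH /= ev_cat /conjg rV /= mul1g !mulgA.
Qed.

Lemma alt_mirrorP x i j l n : wall_at x i -> wall_at x j ->
  cut l (ev (alt_word i j n) x) (ev (alt_word i j n.+1) x) -> mirror_of l (alt_mirror i j n).
Proof.
move=> wi wj; elim: n i j l wi wj => [|n IH] i j l wi wj.
  rewrite /= mul1g perm1 => c; have [ei ci] := andP wi.
  by rewrite (cut_uniq ei c ci).
rewrite (ev_altS i j n.+1) (ev_altS i j n) => c.
have ee := alt_edge n wj wi; have [l' cl' _] := edge_wall ee.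
exact: (mirror_conj (r_mirror i).1 ee cl' c (IH _ _ _ wj wi cl')).
Qed.

Lemma alt_cut x i j l m : cut l x (ev (alt_word i j m) x) ->
  exists2 n, n < m & cut l (ev (alt_word i j n) x) (ev (alt_word i j n.+1) x).
Proof.
elim: m => [|m IH]; first by rewrite /cut perm1 eqxx.
have [/IH[n nm cn] _|nc c] := boolP (cut l x (ev (alt_word i j m) x)).
  by exists n => //; apply: ltnW.
by exists m => //; rewrite (cut_xor l x) (negbTE nc) c.
Qed.

(** * Rigidity of automorphisms and uniqueness of mirrors *)

Lemma edge_wall_at x y : e x y -> exists2 i, wall_at x i & y = r i x.
Proof.
move=> exy; have [i ci _] := edge_wall exy.
have ry := (r_mirror i).2 _ _ exy ci.
by exists i => //; rewrite /wall_at ry exy ci.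
Qed.

(* The neighbour [y] lies on a geodesic from [x] to its antipode in the dihedral
   cycle, and [g] fixes the antipode since it is an end of an edge of the wall
   [i]; the only other neighbour of [x] with that property is [r i x]. *)
Lemma mirror_fix_near (g : {perm T}) i x y : is_automorphism e g ->
  (forall u v, e u v -> cut i u v -> g u = u) -> wall_at x i -> e x y -> g y = y.
Proof.
move=> ag fg wi /edge_wall_at[j wj ->].
have [ei ci] := andP wi; have [ej cj] := andP wj.
have fg' u v : e u v -> cut i u v -> g v = v.
  by move=> euv cuv; apply: (fg v u); rewrite 1?e_sym 1?cut_sym.
have gx : g x = x by apply: (fg _ _ ei ci).
have gix := fg' _ _ ei ci.
have [->//|nij] := eqVneq j i.
have [m dm] := dihedral_ex x i j; have [m0 hm _] := dm.
have dm' := dihedralC dm.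
have anti : ev (alt_word i j m) x = ev (alt_word j i m) x by apply: (alt_antipode hm); rewrite addnn.
have gm : g (ev (alt_word i j m) x) = ev (alt_word i j m) x.
  have c1 : cut i x (ev (alt_word i j m) x).
    by have := @dihedral_far x i j m wi wj dm m.-1; rewrite prednK // leqnn; apply.
  have c2 : ~~ cut i x (ev (alt_word j i m.-1) x) by apply: (dihedral_near wi wj dm); rewrite ltn_predL.
  apply: (fg' (ev (alt_word j i m.-1) x)).
    by rewrite anti -{2}(prednK m0); apply: alt_edge.
  by rewrite (cut_xor i x) c1 (negbTE c2).
have egy : e x (g (r j x)) by rewrite -{1}gx ag.
have [l cl _] := edge_wall egy.
have clm : cut l x (ev (alt_word i j m) x).
  rewrite -{1}gx -gm (cut_aut _ _ ag ej cj) ?gx // anti.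
  by have := @dihedral_far x j i m wj wi dm' m.-1; rewrite prednK // leqnn; apply.
have [n nm cn] := alt_cut clm.
have := (alt_mirrorP wi wj cn).2 _ _ egy cl; rewrite alt_mirrorE => gyE.
(* The vertex [g (r j x)] is reached after [2n+1] steps of the cycle. On the first half it lies
   beyond the wall [i], which would force [g (r j x) = r i x = g (r i x)]; on the second half it
   lies beyond the wall [j], so it equals [r j x]. *)
have [le|gt] := ltnP n.*2 m.
  have cgy := dihedral_far wi wj dm le; rewrite gyE in cgy.
  have /perm_inj rij : g (r i x) = g (r j x) by rewrite gix; apply: (r_mirror i).2.
  by case/eqP: nij; apply: (cut_uniq ej cj); rewrite -rij.
have nm2 : n.*2.+1 < m.*2 by rewrite -doubleS leq_double.
have anti' : ev (alt_word i j n.*2.+1) x = ev (alt_word j i (m.*2 - n.*2.+1)) x.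
  by apply: (alt_antipode hm); rewrite subnKC // ltnW.
have q0 : 0 < m.*2 - n.*2.+1 by rewrite subn_gt0.
have := @dihedral_far x j i m wj wi dm' (m.*2 - n.*2.+1).-1.
rewrite prednK // -anti' gyE => h; apply/esym/(r_mirror j).2 => //; apply: h.
by rewrite leq_subLR -addnn leq_add2r ltnW.
Qed.

(* For an edge [x y] with mirror [r j], the automorphism [r j * (r j ^ g)] fixes
   the ends of the edges of the wall [j]; hence [g] commutes with [r j] near [x]
   and also fixes the neighbours of [y]. *)
Lemma automorphism_rigid (g : {perm T}) x : is_automorphism e g -> g x = x ->
  (forall y, e x y -> g y = y) -> g = 1%g.
Proof.
move=> ag gx gnx; apply/permP => z; rewrite perm1.
have /connectP[p pp ->] := e_conn x z.
elim: p x gx gnx pp => [|y p IH] x gx gnx //= /andP[exy]; apply: IH; first exact: gnx.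
move=> w eyw; have gy := gnx _ exy.
have [j cj _] := edge_wall exy.
have rx := (r_mirror j).2 _ _ exy cj.
have cj' : cut j (g x) (g y) by rewrite gx gy.
have mj := mirror_conj ag exy cj cj' (r_mirror j).
have ey : e y x by rewrite e_sym.
have ry : r j y = x by rewrite -rx r_inv.
have hw : (r j * (r j ^ g))%g w = w.
  apply: (@mirror_fix_near _ j y) => //.
  - by apply: automorphismM; [case: (r_mirror j)|case: mj].
  - move=> u v euv cuv; rewrite permM ((r_mirror j).2 _ _ euv cuv); by apply: mj.2; rewrite 1?e_sym 1?cut_sym.
  - by rewrite /wall_at ry ey cut_sym.
have gz : g (r j w) = r j w by apply: gnx; rewrite -ry (r_mirror j).1.
by move: hw; rewrite permM -{1}gz permJ r_inv.
Qed.

Lemma mirror_uniq i x y a b : e x y -> cut i x y -> mirror_of i a -> mirror_of i b -> a = b.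
Proof.
move=> exy c [aa ea] [ab eb].
suff h : (a * b^-1 = 1)%g by rewrite -[a](mulgKV b) h mul1g.
have ah : is_automorphism e (a * b^-1)%g by apply: automorphismM => //; apply: automorphismV.
have fh u v : e u v -> cut i u v -> (a * b^-1)%g u = u.
  by move=> euv cuv; rewrite permM (ea _ _ euv cuv) -(eb _ _ euv cuv) permK.
have rx := (r_mirror i).2 _ _ exy c.
apply: (automorphism_rigid ah (fh _ _ exy c)) => z exz.
by apply: (mirror_fix_near ah fh _ exz); rewrite /wall_at rx exy.
Qed.

Lemma cut_edge l x z : cut l x z -> exists p q, e p q && cut l p q.
Proof.
have /connectP[p pp ->] := e_conn x z; elim: p x pp => [|y p IH] x /=; first by rewrite /cut eqxx.
case/andP=> exy pp c; have [cy|ncy] := boolP (cut l x y); first by exists x, y; rewrite exy.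
by apply: (IH y pp); rewrite (cut_xor l x) (negbTE ncy) c.
Qed.

(** * Exchange and simple transitivity at a base vertex *)

Section BasePoint.
Variable x0 : T.
Local Notation gens := (all (wall_at x0)).
Local Notation len g := (walldist x0 (g x0)).

(** The path spelled by [q] crosses [l] at some letter, and multiplying by [t] deletes it. If [l] is
    the wall of the head letter [u], uniqueness of mirrors gives [t = r u]; otherwise [l] and [t]
    are transported by [r u] and the tail is treated. *)
Lemma exchange q t l : gens q -> mirror_of l t -> cut l x0 (ev q x0) ->
  exists q', [/\ gens q', ev q' = (ev q * t)%g & (size q').+1 = size q].
Proof.
elim: q t l => [|u q IH] t l; first by rewrite /cut perm1 eqxx.
case/andP=> wu gq mt; rewrite ev_cons => c; have [eu cu] := andP wu.
have [lu|nlu] := eqVneq l u.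
  subst l; exists q; split => //.
  by rewrite /= (mirror_uniq eu cu mt (r_mirror u)) -mulgA r2 mulg1.
have nc : ~~ cut l x0 (r u x0) by apply: contra nlu => /(cut_uniq eu cu)->.
have cr : cut l (r u x0) (r u (ev q x0)) by rewrite (cut_xor l x0) c (negbTE nc).
have [p [s /andP[eps cps]]] := cut_edge c.
have au := (r_mirror u).1.
have erps : e (r u p) (r u s) by rewrite au.
have [l' cl' _] := edge_wall erps.
have cl'' : cut l (r u (r u p)) (r u (r u s)) by rewrite !r_inv.
rewrite (cut_aut _ _ au erps cl' cl'') in cr.
have mt' := mirror_conj au eps cps cl' mt.
have [q' [gq' evq' sq']] := IH _ _ gq mt' cr.
exists (u :: q'); split; rewrite /= ?wu ?sq' // evq' /conjg rV.
by rewrite -!mulgA r2 mulg1.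
Qed.

Lemma walldist_gen u z : wall_at x0 u ->
  walldist x0 (r u z) = if cut u x0 z then (walldist x0 z).-1 else (walldist x0 z).+1.
Proof.
move=> /andP[eu cu].
have -> : walldist x0 (r u z) = walldist (r u x0) z.
  by rewrite -{1}(r_inv u x0) walldist_aut //; case: (r_mirror u).
case: ifPn => [c|nc]; first by rewrite (walldist_edge eu cu c).
by apply: (@walldist_edge u); rewrite 1?e_sym 1?cut_sym // (cut_xor u x0) cu (negbTE nc).
Qed.

Lemma reduced_word q : gens q -> exists q', [/\ gens q', ev q' = ev q & size q' = len (ev q)].
Proof.
elim: q => [|u q IH]; first by exists [::]; rewrite /= perm1 walldistxx.
case/andP=> wu /IH[q' [gq' evq' sq']]; rewrite ev_cons walldist_gen //.
case: ifPn => c.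
  rewrite -evq' in c; have [q2 [gq2 evq2 sq2]] := exchange gq' (r_mirror u) c.
  by exists q2; rewrite gq2 evq2 evq' -sq' -sq2.
by exists (u :: q'); rewrite /= wu gq' evq' sq'.
Qed.

(** A reduced word for an element fixing [x0] has length zero. Together with [geodesic_word] this
    makes the action simply transitive. *)
Lemma ev_eq1 q : gens q -> ev q x0 = x0 -> ev q = 1%g.
Proof.
by move=> /reduced_word[q' [_ <- sq']] h; move: sq'; rewrite h walldistxx => /size0nil->.
Qed.

Lemma ev_rev q : ev (rev q) = ((ev q)^-1)%g.
Proof.
elim: q => [|u q IH]; first by rewrite invg1.
by rewrite rev_cons -cats1 ev_cat IH /= invMg rV mul1g.
Qed.

Lemma ev_inj p q : gens p -> gens q -> ev p x0 = ev q x0 -> ev p = ev q.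
Proof.
move=> gp gq h; have := @ev_eq1 (rev q ++ p).
rewrite all_cat all_rev gp gq ev_cat ev_rev permM h permK => /(_ isT erefl) h1.
by rewrite -[RHS]mul1g -h1 mulgKV.
Qed.

Lemma geodesic_word z : exists q, [/\ gens q, ev q x0 = z & size q = walldist x0 z].
Proof.
suff [q [gq <-]] : exists q, gens q /\ ev q x0 = z.
  by have [q' [gq' <- sq']] := reduced_word gq; exists q'.
have /connectP[p] := e_conn x0 z.
elim/last_ind: p z => [|p w IH] z /=; first by move=> _ ->; exists [::]; rewrite /= perm1.
rewrite rcons_path last_rcons => /andP[pp ew] ->.
have [q [gq hq]] := IH _ pp erefl; rewrite -hq in ew.
have : e x0 (((ev q)^-1)%g w) by rewrite -(ev_aut q) permKV.
case/edge_wall_at => u wu hu.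
exists (q ++ [:: u]); rewrite all_cat gq /= wu; split => //.
by rewrite ev_cat /= mul1g permM -hu permKV.
Qed.

End BasePoint.

(** * Dihedral orbits and gates *)

Section Orbit.
Variables (x : T) (i j : W) (m : nat).

Definition dihedral_orbit y := [exists p : 'I_m.+1,
  (y == ev (alt_word i j p) x) || (y == ev (alt_word j i p) x)].

Lemma dihedral_orbitP y : reflect
  (exists2 p, p <= m & y = ev (alt_word i j p) x \/ y = ev (alt_word j i p) x)
  (dihedral_orbit y).
Proof.
apply: (iffP existsP) => [[p /orP h]|[p pm h]].
  by exists p; [rewrite -ltnS | case: h => /eqP; [left|right]].
by exists (inord p); rewrite inordK //; case: h => ->; rewrite eqxx ?orbT.
Qed.
End Orbit.

Lemma dihedral_orbitC x i j m y : dihedral_orbit x i j m y = dihedral_orbit x j i m y.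
Proof. by apply/existsP/existsP => -[p h]; exists p; rewrite orbC. Qed.

Lemma dihedral_orbit_gen x i j m y : dihedral x i j m ->
  dihedral_orbit x i j m y -> dihedral_orbit x i j m (r i y).
Proof.
case=> m0 hm _ /dihedral_orbitP[p pm [->|->]]; apply/dihedral_orbitP.
  case: p pm => [|p] pm; first by exists 1 => //; left; rewrite ev_altS.
  by exists p; [apply: ltnW | right; rewrite ev_altS r_inv].
rewrite -ev_altS; move: pm; rewrite leq_eqVlt => /predU1P[->|pm]; last by exists p.+1 => //; left.
(* Beyond the antipode, [m+1] steps one way round the cycle equal [m-1] steps the other way. *)
exists m.-1; first exact: leq_pred.
by right; apply: (alt_antipode hm); rewrite addSnnS prednK // addnn.
Qed.

Lemma dihedral_orbit_alt x i j m n y : dihedral x i j m ->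
  dihedral_orbit x i j m y -> dihedral_orbit x i j m (ev (alt_word i j n) y).
Proof.
elim: n i j => [|n IH] i j dm oy; first by rewrite perm1.
rewrite ev_altS; apply: dihedral_orbit_gen => //.
by rewrite dihedral_orbitC; apply: IH; [apply: dihedralC | rewrite dihedral_orbitC].
Qed.

(* The vertex of the dihedral orbit of [x] nearest to [z] is on the side of [z]
   of every wall of the cycle, so it can only be the antipode of [x]. *)
Lemma walldist_gate x i j m z : wall_at x i -> wall_at x j -> dihedral x i j m ->
  cut i x z -> cut j x z -> walldist x z = walldist x (ev (alt_word i j m) x) + walldist (ev (alt_word i j m) x) z.
Proof.
move=> wi wj dm ci cj; have [m0 hm _] := dm; have dm' := dihedralC dm.
have ox : dihedral_orbit x i j m x by apply/dihedral_orbitP; exists 0 => //; left; rewrite perm1.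
case: (arg_minnP (fun y => walldist y z) ox) => y oy ymin.
(* A mirror that keeps [y] in the orbit cannot bring it nearer to [z], so its wall does not separate
   them. *)
have same l a : mirror_of l a -> dihedral_orbit x i j m (a y) -> ~~ cut l y z.
  by move=> ma /ymin; apply: contraL; rewrite -ltnNge; apply: walldist_reflect.
have nci : ~~ cut i y z by apply: (same _ _ (r_mirror i)); apply: dihedral_orbit_gen.
have ncj : ~~ cut j y z.
  apply: (same _ _ (r_mirror j)); rewrite dihedral_orbitC.
  by apply: dihedral_orbit_gen => //; rewrite dihedral_orbitC.
have cyi : cut i x y by move: ci; rewrite (cut_xor i y) cut_sym (negbTE nci); case: (cut i x y).
have cyj : cut j x y by move: cj; rewrite (cut_xor j y) cut_sym (negbTE ncj); case: (cut j x y).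
have anti : ev (alt_word i j m) x = ev (alt_word j i m) x by apply: (alt_antipode hm); rewrite addnn.
have ym : y = ev (alt_word i j m) x.
  case/dihedral_orbitP: oy cyi cyj => p; rewrite leq_eqVlt => /predU1P[-> [->|->] //|pm [->|->]].
    by rewrite (negbTE (dihedral_near wj wi dm' pm)).
  by rewrite (negbTE (dihedral_near wi wj dm pm)).
rewrite -ym /walldist.
have -> : [set l | cut l x z] = [set l | cut l x y] :|: [set l | cut l y z].
  apply/setP => l; rewrite !inE (cut_xor l y) (cut_sym l y x).
  case c: (cut l x y) => //=; last by case: (cut l y z).
  rewrite ym in c; have [n nm cn] := alt_cut c.
  rewrite (negbTE (same _ _ (alt_mirrorP wi wj cn) _)) //.
  by rewrite alt_mirrorE; apply: dihedral_orbit_alt.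
rewrite cardsU; suff -> : [set l | cut l x y] :&: [set l | cut l y z] = set0 by rewrite cards0 subn0.
apply/setP => l; rewrite !inE; case c: (cut l x y) => //=.
rewrite ym in c; have [n nm cn] := alt_cut c.
apply/negbTE/(same _ _ (alt_mirrorP wi wj cn)).
by rewrite alt_mirrorE; apply: dihedral_orbit_alt.
Qed.

(** * Matsumoto's induction and the universal property *)

Section UniversalProperty.
Variable x0 : T.
Local Notation gens := (all (wall_at x0)).

Lemma gens_alt i j n : wall_at x0 i -> wall_at x0 j -> gens (alt_word i j n).
Proof. by elim: n i j => //= n IH i j wi wj; rewrite wi IH. Qed.

Lemma walldist_alt i j m p : wall_at x0 i -> wall_at x0 j -> i != j -> dihedral x0 i j m ->
  p <= m -> walldist x0 (ev (alt_word i j p) x0) = p.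
Proof.
elim: p i j => [|p IH] i j wi wj nij dm pm; first by rewrite perm1 walldistxx.
rewrite ev_altS walldist_gen // (negbTE (dihedral_near wi wj dm pm)) IH 1?eq_sym //.
  exact: dihedralC.
exact: ltnW.
Qed.

Lemma dihedral_order i j m : wall_at x0 i -> wall_at x0 j -> dihedral x0 i j m ->
  m = #[r j * r i]%g.
Proof.
move=> wi wj [m0 hm mmin]; apply/eqP; rewrite eqn_leq; apply/andP; split.
  rewrite leqNgt; apply/negP => lt; apply: (mmin #[r j * r i]%g); rewrite ?order_gt0 //.
  by rewrite ev_alt2 expg_order perm1.
apply: dvdn_leq => //; rewrite order_dvdn -ev_alt2; apply/eqP.
by apply: ev_eq1 hm; apply: gens_alt.
Qed.

Lemma walldist_word q : gens q -> walldist x0 (ev q x0) <= size q.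
Proof.
elim: q => [|i q IH] /=; first by rewrite perm1 walldistxx.
case/andP=> wi /IH le; rewrite -/(ev (i :: q)) ev_cons walldist_gen //.
by case: ifP => _ //; apply: leq_trans (leq_pred _) (leqW le).
Qed.

Variables (H : group_str) (h : W -> H).
Hypothesis h_rel : forall i j, wall_at x0 i -> wall_at x0 j ->
  gpow (gmul (h i) (h j)) #[r i * r j]%g = gone H.

Lemma gen_invol i : wall_at x0 i -> gmul (h i) (h i) = gone H.
Proof. by move=> wi; have := h_rel wi wi; rewrite r2 order1 /= gmul1r. Qed.

(** Induction on the length. Equal heads are cancelled. If the heads [i] and [j] differ, both walls
    separate [z] from [x0], so [z] has reduced words [alt_word i j m ++ q0] and
    [alt_word j i m ++ q0] with a common tail. Each given word shares its head with one of these and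
    agrees with it by induction; the braid relation links the two. *)
Lemma reduced_gev p q : gens p -> gens q -> size p = walldist x0 (ev p x0) -> size q = size p ->
  ev p x0 = ev q x0 -> gev h p = gev h q.
Proof.
have [n] := ubnP (size p); elim: n p q => // n IH p q.
case: p q => [|i p] [|j q] //; rewrite [size (i :: p)]/= [size (j :: q)]/= ltnS.
move=> pn /andP[wi gp] /andP[wj gq] sz [sqp] epq.
set z := ev (i :: p) x0 in sz epq.
have step k s : wall_at x0 k -> gens s -> size s = size p -> z = ev (k :: s) x0 ->
    [/\ cut k x0 z, walldist x0 (ev s x0) = size s & ev s x0 = r k z].
  move=> wk gs ss zE; have rz : ev s x0 = r k z by rewrite zE ev_cons r_inv.
  have := walldist_word gs; rewrite rz walldist_gen //.
  by case: ifP => [c _|_]; rewrite -sz //= ss ltnNge leqnSn.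
have [ci szp rp] := step i p wi gp erefl erefl.
have [cj szq rq] := step j q wj gq sqp epq.
have [ij|nij] := eqVneq i j.
  subst j; rewrite /= (IH p q) ?rp ?rq //; by rewrite -rp szp.
have [m dm] := dihedral_ex x0 i j; have dm' := dihedralC dm; have [m0 hm _] := dm.
have evC : ev (alt_word i j m) = ev (alt_word j i m).
  by apply: (@ev_inj x0); rewrite ?gens_alt //; apply: (alt_antipode hm); rewrite addnn.
have := walldist_gate wi wj dm ci cj; rewrite (walldist_alt wi wj nij dm (leqnn m)) -sz.
set z0 := ((ev (alt_word i j m))^-1)%g z.
have zz0 : z = ev (alt_word i j m) z0 by rewrite permKV.
rewrite [in X in _ + X]zz0 walldist_aut; last exact: ev_aut.
have [q0 [gq0 eq0 <-]] := geodesic_word x0 z0.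
rewrite -(prednK m0) addSn => -[sm].
have use k l s : wall_at x0 k -> wall_at x0 l -> gens s -> size s = size p ->
    walldist x0 (ev s x0) = size s -> ev s x0 = r k z -> ev (alt_word k l m) = ev (alt_word i j m) ->
    gev h (k :: s) = gmul (gev h q0) (gev h (alt_word k l m)).
  move=> wk wl gs ss ds es ekl; rewrite [LHS]/= (IH s (alt_word l k m.-1 ++ q0)) ?ss //.
  - by rewrite gev_cat -gmulA -{2}(prednK m0).
  - by rewrite all_cat gens_alt.
  - by rewrite ds.
  - by rewrite size_cat size_alt_word sm.
  rewrite ev_cat permM eq0 es zz0 -ekl -{1}(prednK m0) ev_altS r_inv //.
rewrite (use i j p) // (use j i q) //; congr (gmul _ _).
apply: (@gev_antipode _ _ _ _ _ m); rewrite ?gen_invol ?addnn //.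
  by rewrite gev_alt2 (dihedral_order wi wj dm) h_rel.
by rewrite gev_alt2 (dihedral_order wj wi dm') h_rel.
Qed.

Lemma geodesic_word_ex z :
  exists q, [&& gens q, ev q x0 == z & size q == walldist x0 z].
Proof. by have [q [gq eq sq]] := geodesic_word x0 z; exists q; rewrite gq eq sq !eqxx. Qed.

Definition word z := xchoose (geodesic_word_ex z).

Lemma wordP z : [/\ gens (word z), ev (word z) x0 = z & size (word z) = walldist x0 z].
Proof. by have /and3P[-> /eqP-> /eqP->] := xchooseP (geodesic_word_ex z). Qed.

(** The head letter moves the vertex one step away from [x0] or one step nearer. In both cases two
    reduced words for the same vertex are compared, so evaluating chosen geodesic words is
    compatible with products. *)
Lemma gev_word q : gens q -> gev h (word (ev q x0)) = gev h q.
Proof.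
elim: q => [_|i q IH].
  rewrite perm1; have [_ _] := wordP x0.
  by rewrite walldistxx => /size0nil->.
case/andP=> wi gq; rewrite ev_cons [RHS]/= -IH //; set z := ev q x0.
have [gw ew sw] := wordP z; have [gw' ew' sw'] := wordP (r i z).
have dz := walldist_gen z wi; case: ifPn dz => c dz.
  have -> : gev h (word z) = gmul (gev h (word (r i z))) (h i).
    apply: (@reduced_gev _ (i :: word (r i z))) => //.
    - by rewrite /= wi.
    - by rewrite ew sw.
    - have d0 : 0 < walldist x0 z.
        by rewrite lt0n; apply: contraL c => /eqP/walldist_eq0<-; rewrite /cut eqxx.
      by rewrite sw /= sw' dz prednK.
    - by rewrite ev_cons ew' r_inv ew.
  by rewrite -gmulA gen_invol // gmul1r.
apply: (@reduced_gev _ (i :: word z)) => //.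
- by rewrite /= wi.
- by rewrite ew' sw' .
- by rewrite sw' dz /= sw.
- by rewrite ew' ev_cons ew.
Qed.

End UniversalProperty.

(** * The mirror group as a Coxeter group, and its Cayley graph *)

Section CoxeterGroup.
Variable x0 : T.
Local Notation gens := (all (wall_at x0)).

Definition gen_walls := [set i | wall_at x0 i].
Definition mirror_group : {group {perm T}} := <<[set r i | i in gen_walls]>>%G.

Lemma mirror_groupP g : reflect (exists2 q, gens q & ev q = g) (g \in mirror_group).
Proof.
apply: (iffP idP) => [|[q gq <-]].
  case/gen_prodgP => n [c cP ->]; elim: n c cP => [|n IH] c cP.
    by exists [::]; rewrite ?big_ord0.
  rewrite big_ord_recr /=.
  have [q gq eq] : exists2 q, gens q & ev q = (\prod_(i < n) c (widen_ord (leqnSn n) i))%g.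
    by apply: IH => i; apply: cP.
  have /imsetP[i wi ->] := cP ord_max; rewrite inE in wi.
  by exists (i :: q); rewrite /= ?wi ?gq // eq.
elim: q gq => [|i q IH] /=; first by rewrite group1.
case/andP=> wi /IH h; rewrite groupM // mem_gen //.
by apply/imsetP; exists i; rewrite ?inE.
Qed.

(** A Coxeter system is defined for a whole group type, so the mirror group is turned into one by
    [subg_of]. *)
Definition cox_gen (c : 'I_#|gen_walls|) : subg_of mirror_group :=
  subg mirror_group (r (enum_val c)).

Lemma cox_genE c : sgval (cox_gen c) = r (enum_val c).
Proof. by rewrite subgK // mem_gen //; apply: imset_f; apply: enum_valP. Qed.

Lemma wall_enum (c : 'I_#|gen_walls|) : wall_at x0 (enum_val c).
Proof. by have := enum_valP c; rewrite inE. Qed.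

Lemma enum_wall i : wall_at x0 i -> exists c : 'I_#|gen_walls|, i = enum_val c.
Proof.
move=> wi; have iA : i \in gen_walls by rewrite inE.
by exists (enum_rank_in iA i); rewrite enum_rankK_in.
Qed.

Lemma mirror_coxeter :
  coxeter_system cox_gen (fun c d => Some #[r (enum_val c) * r (enum_val d)]%g).
Proof.
split; first by move=> c; rewrite r2 order1.
split.
  move=> c d; apply: contraNT; rewrite -ltnNge ltnS leq_eqVlt ltnS leqn0.
  rewrite [_ == 0]eqn0Ngt order_gt0 orbF order_eq1 => /eqP h.
  have rcd : r (enum_val c) = r (enum_val d) by rewrite -(rV (enum_val d)); apply/eqP; rewrite eq_mulgV1 invgK h.
  have [ec cc] := andP (wall_enum c); have [ed cd] := andP (wall_enum d).
  by apply/eqP/enum_val_inj/(cut_uniq ec cc); rewrite rcd.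
split.
  apply/eqP; rewrite eqEsubset subsetT; apply/subsetP => g _.
  have /mirror_groupP[q gq qg] := subgP g.
  have -> : g = subg mirror_group (ev q) by rewrite qg sgvalK.
  elim: q gq {qg} => [_|i q IH] /=; first by rewrite (_ : subg _ _ = 1%g) ?group1 // morph1.
  case/andP=> /enum_wall[c ->] gq.
  have [??] : (ev q \in mirror_group) /\ (r (enum_val c) \in mirror_group).
    split; first by apply/mirror_groupP; exists q.
    by apply: mem_gen; apply: imset_f; apply: enum_valP.
  rewrite subgM // groupM ?IH // mem_gen //.
  by apply/imsetP; exists c.
split.
  move=> c d n [<-]; apply: subg_inj; rewrite (morphX (sgval_morphism _)) ?inE //=.
  by rewrite cox_genE cox_genE expg_order.
move=> H h h_rel.
(* The default [gone H] is taken only at walls that do not pass next to [x0]; words in the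
   generators never contain them. *)
pose h' i := if [pick c : 'I_#|gen_walls| | enum_val c == i] is Some c then h c else gone H.
have h'E c : h' (enum_val c) = h c.
  by rewrite /h'; case: pickP => [d /eqP/enum_val_inj->|/(_ c)]; rewrite ?eqxx.
have rel i j : wall_at x0 i -> wall_at x0 j -> gpow (gmul (h' i) (h' j)) #[r i * r j]%g = gone H.
  by move=> /enum_wall[c ->] /enum_wall[d ->]; rewrite !h'E; apply: h_rel.
exists (fun g : subg_of mirror_group => gev h' (word x0 ((sgval g : {perm T}) x0))).
split => [x y|c].
  have /mirror_groupP[p gp hp] := subgP x; have /mirror_groupP[q gq hq] := subgP y.
  have -> : (sgval (x * y)%g : {perm T}) = ev (q ++ p) by rewrite ev_cat hp hq.
  by rewrite -hp -hq !(gev_word rel) ?all_cat ?gp ?gq // gev_cat.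
have -> : (sgval (cox_gen c) : {perm T}) = ev [:: enum_val c] by rewrite cox_genE /= mul1g.
rewrite (gev_word rel) /= ?gmul1 //.
by rewrite (wall_enum c).
Qed.

(** The isomorphism is the inverse of the orbit map [phi]. A product of permutations applies its
    left factor first, so a generator times [g] sends [x0] to the image under [g] of a neighbour of
    [x0], which is a neighbour of [g x0]. *)
Lemma mirror_cayley : graph_iso e (cayley_rel cox_gen).
Proof.
pose phi (g : subg_of mirror_group) : T := (sgval g : {perm T}) x0.
pose f x : subg_of mirror_group := subg mirror_group (ev (word x0 x)).
have fK : cancel f phi.
  move=> x; have [gw ew _] := wordP x0 x.
  by rewrite /phi /f subgK //; apply/mirror_groupP; exists (word x0 x).
have phi_inj : injective phi.
  move=> g h; rewrite /phi; have /mirror_groupP[p gp hp] := subgP g.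
  have /mirror_groupP[q gq hq] := subgP h.
  by rewrite -hp -hq => /(ev_inj gp gq) h1; apply: subg_inj; rewrite -hp -hq.
have phiK : cancel phi f by move=> g; apply: phi_inj; rewrite fK.
exists f; split; first by exists phi.
move=> x y; rewrite -{2}(fK x) -{2}(fK y); move: (f x) (f y) => g g' {x y}.
have /mirror_groupP[q gq hq] := subgP g'; rewrite /phi -hq.
apply/existsP/idP => [[c /eqP->]|].
  rewrite [sgval _]/= -/(sgval g') -hq -/(sgval (cox_gen c)) cox_genE permM ev_aut e_sym.
  by have [] := andP (wall_enum c).
set x := (sgval g : {perm T}) x0 => exy.
have : e x0 (((ev q)^-1)%g x) by rewrite -(ev_aut q) permKV e_sym.
case/edge_wall_at => i /enum_wall[c ->] hx.
exists c; apply/eqP/phi_inj; rewrite /phi -/x.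
rewrite -[x](permKV (ev q)) hx -permM -cox_genE hq //.
Qed.
End CoxeterGroup.
End MirrorSystem.

(* On one side of the wall the reflection is kept, on the other it is replaced
   by its inverse; nothing forces the given automorphism to be an involution. *)
Lemma mirror_involution (T : finType) (e E : rel T) (a : {perm T}) (u v : T) :
  symmetric e -> (forall x y, E x y -> e x y) -> (forall x y, E x y = E y x) ->
  is_automorphism e a -> (forall x y, E x y -> a x = y /\ a y = x) ->
  let e' := [rel x y | e x y && ~~ E x y] in
  ~~ connect e' u v -> (forall w, connect e' u w || connect e' v w) ->
  (forall w, connect e' v w <-> exists x, connect e' u x /\ a x = w) ->
  exists b : {perm T}, [/\ is_automorphism e b, involutive b,
    forall x y, e x y -> E x y = (connect e' u x != connect e' u y) &
    forall x y, e x y -> connect e' u x != connect e' u y -> b x = y].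
Proof.
move=> e_sym Ee E_sym a_aut a_E e' nuv cover a_side.
have e'_sym : connect_sym e' by apply: sym_connect_sym => x y; rewrite /= e_sym E_sym.
set sd := connect e' u.
have sdV w : connect e' v w = ~~ sd w.
  have := cover w; rewrite -/(sd w); case uw: (sd w) => //= _.
  by apply: contraNF nuv => vw; apply: (connect_trans uw); rewrite e'_sym.
have sda x : sd (a x) = ~~ sd x.
  case ux: (sd x).
    by apply/negbTE; rewrite -sdV; apply/a_side; exists x.
  apply/idPn; rewrite -sdV => /a_side[y [uy /perm_inj yx]].
  by rewrite /sd -yx uy in ux.
have sdaV x : sd ((a^-1)%g x) = ~~ sd x by rewrite -[in RHS](permKV a x) sda negbK.
pose b0 x := if sd x then a x else (a^-1)%g x.
have b0K : involutive b0.
  move=> x; rewrite /b0; case sx: (sd x); first by rewrite sda sx permK.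
  by rewrite sdaV sx permKV.
have EE x y : e x y -> E x y = (sd x != sd y).
  move=> exy; case Exy: (E x y); first by have [<- _] := a_E _ _ Exy; rewrite sda; case: (sd x).
  have step : connect e' x y by apply: connect1; rewrite /= exy Exy.
  by apply/esym/negbTE; rewrite negbK; apply/eqP; apply: same_connect_r.
have b0E x y : e x y -> sd x != sd y -> b0 x = y.
  move=> exy; rewrite -EE // => Exy; have [ax ay] := a_E _ _ Exy.
  by rewrite /b0; case: ifP => // _; rewrite -ay permK.
have imp x y : e x y -> e (b0 x) (b0 y).
  move=> exy; have [sxy|nsxy] := eqVneq (sd x) (sd y).
    rewrite /b0 sxy; case: (sd y); first by rewrite a_aut.
    by rewrite -a_aut !permKV.
  by rewrite !(b0E x y, b0E y x) // 1?e_sym // eq_sym.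
exists (perm (inv_inj b0K)); split=> //.
- move=> x y; rewrite !permE; apply/idP/idP; last exact: imp.
  by move/imp; rewrite !b0K.
- by move=> x; rewrite !permE.
- by move=> x y exy nxy; rewrite permE; apply: b0E.
Qed.

Theorem mirror_graph_coxeter (T : finType) (e : rel T) :
  simple_graph e -> mirror_graph e -> coxeter_cayley_graph e.
Proof.
move=> [e_sym e_irr] [[[x0 _] e_conn] [k [E [Ee [E_sym [E_ex mir]]]]]].
have side_ex i : exists (sd : T -> bool) (b : {perm T}),
    [/\ is_automorphism e b, involutive b,
      forall x y, e x y -> E i x y = (sd x != sd y) &
      forall x y, e x y -> sd x != sd y -> b x = y].
  have [a [a_aut [a_E [u [v [nuv [cover [a_side _]]]]]]]] := mir i.
  exists (connect [rel x y | e x y && ~~ E i x y] u).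
  by apply: (mirror_involution (a := a) (v := v)) => //; apply: (Ee i).
have [side /fin_all_exists[r rP]] := fin_all_exists side_ex.
have wall x y : e x y -> exists2 i, cut side i x y & forall j, cut side j x y -> j = i.
  move=> exy; have [i [Ei i_uniq]] := E_ex _ _ exy.
  have ES j : E j x y = cut side j x y by case: (rP j) => _ _ h _; apply: h.
  by exists i => [|j]; rewrite -ES // => /i_uniq.
have r_mir i : mirror_of e side i (r i) by case: (rP i).
have r_inv i : involutive (r i) by case: (rP i).
exists (subg_of (mirror_group e side r x0)), #|gen_walls e side r x0|.
exists (cox_gen (x0 := x0)); eexists; split; first exact: mirror_coxeter.
exact: mirror_cayley.
Qed.

Local Open Scope ring_scope.

(** * Tope graphs of reflection arrangements are mirror graphs *)

Section Dot.
Variable n : nat.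
Implicit Types (x y z u v : point n) (t : R).

Lemma dotE x y : dot x y = \sum_c x c * y c.
Proof. by []. Qed.

Lemma dotC x y : dot x y = dot y x.
Proof. by rewrite !dotE; apply: eq_bigr => c _; rewrite mulrC. Qed.

Definition shift x t y : point n := fun c => x c + t * y c.
Arguments shift x t%_ring_scope y _.

Lemma dot_shift v x t y : dot v (shift x t y) = dot v x + t * dot v y.
Proof.
rewrite !dotE mulr_sumr -big_split; apply: eq_bigr => c _ /=.
by rewrite /shift; ring.
Qed.

Lemma reflect_inE v x : reflect_in v x = shift x (- (2 * (dot x v / dot v v))) v.
Proof.
apply: functional_extensionality => c; rewrite /reflect_in /shift.
by rewrite mulNr.
Qed.

Lemma dot_gt0 v : (exists c, v c <> 0) -> 0 < dot v v.
Proof.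
case=> c /eqP vc; rewrite dotE (bigD1 c) //= ltr_pwDl ?sumr_ge0 //.
  by rewrite lt_def mulf_neq0 //= -expr2 sqr_ge0.
by move=> d _; rewrite -expr2 sqr_ge0.
Qed.

Lemma dot_eq0 v : dot v v = 0 -> v =1 fun=> 0.
Proof.
move=> v0 c; apply/eqP; apply: contraT => /eqP vc.
by have := @dot_gt0 v (ex_intro _ c vc); rewrite v0 ltxx.
Qed.

(** The component [w] of [u] orthogonal to [v] lies in the hyperplane of [v], hence in that of [u];
    it is then orthogonal to itself and vanishes. *)
Lemma hyperplane_sub v u : (exists c, v c <> 0) ->
  (forall x, hyperplane v x -> hyperplane u x) ->
  exists k, forall x, dot u x = k * dot v x.
Proof.
move=> /dot_gt0 v0 sub; set k := dot u v / dot v v; exists k.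
pose w := shift u (- k) v.
have vw : dot v w = 0.
  by rewrite dot_shift /k mulNr mulfVK ?gt_eqF // dotC subrr.
have uw : dot u w = 0 by apply: sub.
have w0 : dot w w = 0.
  by rewrite {2}/w dot_shift !(dotC w) uw vw mulr0 addr0.
move=> x; have : dot x w = 0.
  by rewrite dotE big1 // => c _; rewrite (dot_eq0 w0) mulr0.
by rewrite dot_shift !(dotC x) => /eqP; rewrite mulNr subr_eq0 => /eqP.
Qed.

Lemma dot_reflect v x y : dot x (reflect_in v y) = dot (reflect_in v x) y.
Proof. rewrite !reflect_inE dot_shift [RHS]dotC dot_shift (dotC y x); ring. Qed.

Lemma reflect_inK v : (exists c, v c <> 0) -> involutive (reflect_in v).
Proof.
move=> /dot_gt0 v0 x; apply: functional_extensionality => c.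
rewrite !reflect_inE [dot (shift _ _ _) v]dotC dot_shift (dotC v x) /shift.
by field; rewrite gt_eqF.
Qed.

End Dot.
Arguments shift {n} x t%_ring_scope y _.

(** * Small perturbations and generic points *)

Lemma sgr_perturb1 (a b : R) : exists2 d, 0 < d & a != 0 -> forall t, 0 <= t <= d -> Num.sg (a + t * b) = Num.sg a.
Proof.
have b1 : 0 < 1 + `|b| by rewrite ltr_pwDl.
have [->|a0] := eqVneq a 0; first by exists 1.
exists (`|a| / (2 * (1 + `|b|))); first by rewrite divr_gt0 ?normr_gt0 // mulr_gt0.
move=> _ t /andP[t0]; rewrite ler_pdivlMr ?mulr_gt0 // => tb.
have : `|t * b| < `|a|.
  rewrite normrM (ger0_norm t0); have : 0 < `|a| by rewrite normr_gt0.
  by move: tb; move: `|a| `|b| => A B; lra.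
have [pa|na] := ltP 0 a.
  rewrite (gtr0_norm pa) ltr_norml => /andP[h _].
  by rewrite (gtr0_sg pa) gtr0_sg //; lra.
have na' : a < 0 by rewrite lt_neqAle a0.
rewrite (ltr0_norm na') ltr_norml => /andP[_ h].
by rewrite (ltr0_sg na') ltr0_sg //; lra.
Qed.

Lemma finite_radius (I : finType) (P : I -> R -> Prop) :
  (forall i, exists2 d, 0 < d & forall t, 0 <= t <= d -> P i t) ->
  exists2 d, 0 < d & forall i t, 0 <= t <= d -> P i t.
Proof.
move=> h; suff [d d0 dP] : exists2 d, 0 < d & forall i t, i \in enum I -> 0 <= t <= d -> P i t.
  by exists d => // i t; apply: dP; rewrite mem_enum.
elim: (enum I) => [|i s [d d0 dP]]; first by exists 1.
have [d' d'0 d'P] := h i; exists (Num.min d d'); first by rewrite lt_min d0.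
move=> j t; rewrite inE le_min => /predU1P[->|js] /and3P[t0 td td'].
  by apply: d'P; rewrite t0.
by apply: dP; rewrite ?t0.
Qed.

Lemma sgr_perturb (I : finType) (a b : I -> R) :
  exists2 d, 0 < d & forall i t, 0 <= t <= d -> a i != 0 -> Num.sg (a i + t * b i) = Num.sg (a i).
Proof.
apply: finite_radius => i; have [d d0 dP] := sgr_perturb1 (a i) (b i).
by exists d => // t ht ai; apply: dP.
Qed.

Lemma dot_perturb n (I : finType) (w : I -> point n) x y :
  exists2 d, 0 < d & forall i t, 0 <= t <= d -> dot (w i) x != 0 ->
    Num.sg (dot (w i) (shift x t y)) = Num.sg (dot (w i) x).
Proof.
have [d d0 dP] := sgr_perturb (fun i => dot (w i) x) (fun i => dot (w i) y).
by exists d => // i t ht wx; rewrite dot_shift dP.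
Qed.

(** The vectors [u j] are treated one by one: a point orthogonal to [u j] is moved along [u j]
    itself, by a step too small to change any nonzero sign obtained before. *)
Lemma generic_point n (I J : finType) (w : I -> point n) (u : J -> point n) x :
  (forall j, exists c, u j c <> 0) ->
  exists y, (forall i, dot (w i) x != 0 -> Num.sg (dot (w i) y) = Num.sg (dot (w i) x)) /\
            forall j, dot (u j) y != 0.
Proof.
move=> u0; suff [y [wy uy]] : exists y,
    (forall i, dot (w i) x != 0 -> Num.sg (dot (w i) y) = Num.sg (dot (w i) x)) /\
    forall j, j \in enum J -> dot (u j) y != 0.
  by exists y; split=> // j; apply: uy; rewrite mem_enum.
elim: (enum J) => [|j s [y [wy uy]]]; first by exists x.
have [uj|uj] := eqVneq (dot (u j) y) 0; last first.
  by exists y; split=> // l; rewrite inE => /predU1P[->|/uy].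
have [d d0 dP] := dot_perturb w y (u j).
have [d' d'0 d'P] := dot_perturb u y (u j).
exists (shift y (Num.min d d') (u j)); split.
  move=> i wi; rewrite -(wy i wi) dP //; first by rewrite le_min ltW // ltW //= ge_min lexx.
  by rewrite -sgr_eq0 wy // sgr_eq0.
move=> l; rewrite inE => /predU1P[->|ls].
  rewrite dot_shift uj add0r mulf_neq0 ?gt_eqF ?lt_min ?d0 //.
  exact: dot_gt0.
rewrite -sgr_eq0 d'P ?sgr_eq0 ?uy //.
by rewrite le_min ltW // ltW //= ge_min lexx orbT.
Qed.

(** * Segments, half-spaces and connectedness *)

Section SameComponent.
Variable n : nat.
Implicit Types (x y z v : point n).

Definition segment_pt x y (t : R) : point n := shift x t (fun c => y c - x c).
Arguments segment_pt x y t%_ring_scope _.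

Lemma dot_segment v x y t : dot v (segment_pt x y t) = dot v x + t * (dot v y - dot v x).
Proof.
rewrite dot_shift; congr (_ + _ * _).
by rewrite !dotE -sumrB; apply: eq_bigr => c _; rewrite mulrBr.
Qed.

Lemma dist2E x y : dist2 x y = \sum_c (x c - y c) ^+ 2.
Proof. by []. Qed.

Lemma open_segment (O : point n -> Prop) x y s : Defs.open_set O -> O (segment_pt x y s) ->
  exists2 d, 0 < d & forall t, `|t - s| < d -> O (segment_pt x y t).
Proof.
move=> oO /oO[eps [/RltP eps0 near]].
set D := dist2 y x.
have D0 : 0 <= D.
  by rewrite /D dist2E; apply: sumr_ge0 => c _; rewrite sqr_ge0.
(* The squared distance is [r^2 * D] with [r = |t - s|], and [r < 1] gives [r^2 * D <= r * D];
   adding 1 to [D] avoids division by zero. *)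
exists (Num.min 1 (eps / (1 + D))).
  by rewrite lt_min ltr01 divr_gt0 // ltr_pwDl.
move=> t; rewrite lt_min ltr_pdivlMr ?ltr_pwDl // => /andP[t1 tD].
apply/near/RltP.
have -> : dist2 (segment_pt x y s) (segment_pt x y t) = (t - s) * (t - s) * D.
  rewrite /D !dist2E mulr_sumr; apply: eq_bigr => c _.
  by rewrite /segment_pt /shift; ring.
have -> : (t - s) * (t - s) = `|t - s| * `|t - s| by rewrite -normrM ger0_norm // -expr2 sqr_ge0.
move: (normr_ge0 (t - s)) t1 tD; move: `|t - s| => r r0 r1 rD.
have : r * r <= r by rewrite ler_piMl // ltW.
nra.
Qed.

(** Supremum argument: among the parameters up to [b] whose points lie in [O1], the least upper
    bound can have its point neither in [O1] nor in [O2], both being open. *)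
Lemma segment_connected x y : connected_set (fun z => exists2 t, 0 <= t <= 1 & z = segment_pt x y t).
Proof.
move=> O1 O2; wlog O1x : O1 O2 / O1 (segment_pt x y 0).
  move=> wl oO1 oO2 cov disj.
  have C0 : exists2 t, 0 <= t <= 1 & segment_pt x y 0 = segment_pt x y t by exists 0; rewrite ?lexx ?ler01.
  have [O1x|O2x] := cov _ C0; first exact: (wl O1 O2).
  have cov' z : (exists2 t, 0 <= t <= 1 & z = segment_pt x y t) -> O2 z \/ O1 z.
    by move=> /cov[]; [right|left].
  by case: (wl O2 O1 O2x oO2 oO1 cov') => [z [Cz [O2z O1z]]||]; [by apply: (disj z)|right|left].
move=> oO1 oO2 cov disj; left=> _ [b /andP[b0 b1] ->].
have inC t : 0 <= t <= 1 -> exists2 t', 0 <= t' <= 1 & segment_pt x y t = segment_pt x y t' by exists t.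
have b01 : 0 <= b <= 1 by rewrite b0.
have [//|O2b] := cov _ (inC b b01).
exfalso.
pose A t := 0 <= t <= b /\ O1 (segment_pt x y t).
have A0 : A 0 by split; rewrite ?lexx.
have Abound : bound A by exists b => t [/andP[_ tb] _]; apply/RleP.
have [s [sub slub]] := completeness A Abound (ex_intro _ 0 A0).
have s0 : 0 <= s by apply/RleP/sub.
have sb : s <= b by apply/RleP/slub => t [/andP[_ tb] _]; apply/RleP.
have s01 : 0 <= s <= 1 by rewrite s0 (le_trans sb).
have [O1s|O2s] := cov _ (inC s s01).
  have [d d0 near] := open_segment oO1 O1s.
  have sb' : s < b.
    rewrite lt_neqAle sb andbT; apply/eqP => sbE.
    by apply: (disj (segment_pt x y b)); split; [apply: inC|rewrite -{1}sbE].
  set t := Num.min b (s + d / 2).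
  have st : s < t by rewrite lt_min sb' ltrDl divr_gt0.
  have tb : t <= b by rewrite ge_min lexx.
  have td : t <= s + d / 2 by rewrite ge_min lexx orbT.
  have At : A t.
    split; first by rewrite tb andbT (le_trans s0) // ltW.
    by apply: near; rewrite gtr0_norm ?subr_gt0 //; lra.
  by have /RleP := sub _ At; rewrite leNgt st.
have [d d0 near] := open_segment oO2 O2s.
suff : s <= s - d / 2 by lra.
apply/RleP/slub => t At; apply/RleP; rewrite leNgt; apply/negP => lt.
have ts : t <= s by apply/RleP/sub.
case: At => /andP[t0 tb] O1t.
apply: (disj (segment_pt x y t)); split; first by apply: inC; rewrite t0 (le_trans tb).
by split=> //; apply: near; rewrite ler0_norm ?subr_le0 //; lra.
Qed.

Lemma open_halfspace v : Defs.open_set (fun z => 0 < dot v z).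
Proof.
(* With [N] exceeding the sum of the [|v c|], moving each coordinate by less than [dot v x / N]
   changes the dot product by less than [dot v x]. *)
move=> x vx; set N := 1 + \sum_c `|v c|.
have N0 : 0 < N by rewrite ltr_pwDl // sumr_ge0.
set a := dot v x / N; have a0 : 0 < a by rewrite divr_gt0.
exists (a * a); split; first by apply/RltP; rewrite mulr_gt0.
move=> y /RltP dxy.
have coord c : `|x c - y c| < a.
  have : (x c - y c) ^+ 2 < a ^+ 2.
    apply: le_lt_trans dxy; rewrite dist2E (bigD1 c) //= lerDl.
    by apply: sumr_ge0 => d _; rewrite sqr_ge0.
  by rewrite -[X in X < _]real_normK ?num_real // ltr_pXn2r // ?nnegrE // ltW.
have diff : dot v x - dot v y <= (\sum_c `|v c|) * a.
  rewrite !dotE -sumrB mulr_suml; apply: ler_sum => c _.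
  rewrite -mulrBr; apply: le_trans (ler_norm _) _; rewrite normrM.
  by apply: ler_wpM2l => //; apply: ltW.
have vxE : dot v x = N * a by rewrite /a mulrC mulfVK // gt_eqF.
move: diff; rewrite vxE /N; move: a0; lra.
Qed.

End SameComponent.

(** * Signs of an affine function along a segment *)

Lemma sgr_convex (a b t : R) : Num.sg a = Num.sg b -> 0 <= t <= 1 -> Num.sg (a + t * (b - a)) = Num.sg a.
Proof.
have pos (c d : R) : 0 < c -> 0 < d -> 0 <= t <= 1 -> 0 < c + t * (d - c).
  move=> c0 d0 /andP[t0 t1]; have -> : c + t * (d - c) = (1 - t) * c + t * d by ring.
  have [t1'|] := ltP t 1; first by rewrite ltr_pwDl ?mulr_gt0 ?subr_gt0 // mulr_ge0 // ltW.
  move=> t1'; have -> : t = 1 by apply/eqP; rewrite eq_le t1.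
  by rewrite subrr mul0r add0r mul1r.
move=> ab t01; have [a0|a0|a0] := ltrgt0P a.
- have b0 : 0 < b by rewrite -sgr_gt0 -ab sgr_gt0.
  by rewrite (gtr0_sg a0) gtr0_sg // pos.
- have b0 : b < 0 by rewrite -sgr_lt0 -ab sgr_lt0.
  rewrite (ltr0_sg a0) ltr0_sg // -oppr_gt0.
  have -> : - (a + t * (b - a)) = - a + t * (- b - - a) by ring.
  by rewrite pos ?oppr_gt0.
- have /eqP b0 : b == 0 by rewrite -sgr_eq0 -ab a0 sgr0.
  by rewrite b0 a0 subrr mulr0 addr0.
Qed.

(** The number [a / (a - b)] is the time at which the affine function going from [a] to [b]
    vanishes. *)
Lemma sgr_cross (a b : R) : a != 0 -> b != 0 -> Num.sg a != Num.sg b ->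
  [/\ 0 < a / (a - b) < 1, Num.sg (b - a) = Num.sg b &
      forall t, 0 <= t < a / (a - b) -> Num.sg (a + t * (b - a)) = Num.sg a].
Proof.
have pos (c d : R) : 0 < c -> d < 0 -> 0 < c / (c - d) < 1 /\
    forall t, 0 <= t < c / (c - d) -> 0 < c + t * (d - c).
  move=> c0 d0; have cd : 0 < c - d by lra.
  split; first by rewrite divr_gt0 // ltr_pdivrMr // mul1r ltrDl oppr_gt0.
  by move=> t /andP[t0]; rewrite ltr_pdivlMr //; lra.
move=> a0 b0; have [pa|na|/eqP] := ltrgt0P a; last by rewrite (negbTE a0).
  have [pb|nb|/eqP] := ltrgt0P b; last by rewrite (negbTE b0).
    by rewrite (gtr0_sg pa) (gtr0_sg pb) eqxx.
  move=> _; have [h1 h2] := pos _ _ pa nb; split=> //; first by rewrite !ltr0_sg //; lra.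
  by move=> t /h2 h; rewrite !gtr0_sg.
have [pb|nb|/eqP] := ltrgt0P b; last by rewrite (negbTE b0).
  have na' : 0 < - a by rewrite oppr_gt0.
  have nb' : - b < 0 by rewrite oppr_lt0.
  have [h1 h2] := pos _ _ na' nb'.
  have E : - a / (- a - - b) = a / (a - b) by rewrite -opprD invrN mulrNN.
  rewrite E in h1 h2; move=> _; split=> //; first by rewrite !gtr0_sg //; lra.
  move=> t /h2 h; rewrite !ltr0_sg //; lra.
by rewrite (ltr0_sg na) (ltr0_sg nb) eqxx.
Qed.

(** * Chambers as sign vectors, galleries and reflections *)

Section Arrangement.
Variables (n m : nat) (v : 'I_m -> point n).
Hypothesis v_arr : reflection_arrangement v.

Definition off_walls (x : point n) := forall i, ~ hyperplane (v i) x.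
Definition same_signs x y := forall i, Num.sg (dot (v i) x) = Num.sg (dot (v i) y).

Let v_neq0 i : exists c, v i c <> 0.
Proof. by case: v_arr. Qed.

Lemma off_wallsP x i : off_walls x -> dot (v i) x != 0.
Proof. by move=> /(_ i) h; apply/eqP. Qed.

Lemma same_signs_off x y : same_signs x y -> off_walls x -> off_walls y.
Proof.
by move=> xy ox i /eqP; rewrite -sgr_eq0 -xy sgr_eq0 (negbTE (off_wallsP i ox)).
Qed.

(** The two open half-spaces of a wall would disconnect a connected set meeting both; conversely the
    segment between points of equal signs avoids all walls. *)
Lemma same_componentP x y : off_walls x ->
  same_component off_walls x y <-> same_signs x y.
Proof.
move=> ox; split=> [[C [CU [conC [Cx Cy]]]] i|xy].
  have nE z : dot (fun c => - v i c) z = - dot (v i) z.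
    by rewrite !dotE -sumrN; apply: eq_bigr => c _; rewrite mulNr.
  have := conC _ _ (open_halfspace (v := v i)) (open_halfspace (v := fun c => - v i c)).
  case=> [z /CU/(off_wallsP i)|z [_ []]|h|h].
  - by rewrite nE oppr_gt0 neq_lt => /orP[]; [right|left].
  - by rewrite nE oppr_gt0 => /ltW/le_gtF->.
  - by rewrite !gtr0_sg // h.
  - by move: (h _ Cx) (h _ Cy); rewrite !nE !oppr_gt0 => hx hy; rewrite !ltr0_sg.
have oy := same_signs_off xy ox.
exists (fun z => exists2 t, 0 <= t <= 1 & z = segment_pt x y t); split; last split.
- move=> _ [t t01 ->] i /eqP; rewrite dot_segment -sgr_eq0 sgr_convex // sgr_eq0.
  by rewrite (negbTE (off_wallsP i ox)).
- exact: segment_connected.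
split; [exists 0|exists 1]; rewrite ?lexx ?ler01 //; apply: functional_extensionality => c.
  by rewrite /segment_pt /shift mul0r addr0.
by rewrite /segment_pt /shift mul1r addrC subrK.
Qed.

Lemma separatesP i x y : off_walls x -> off_walls y ->
  separates (v i) (same_component off_walls x) (same_component off_walls y) <->
  Num.sg (dot (v i) x) != Num.sg (dot (v i) y).
Proof.
move=> ox oy; have xx : same_component off_walls x x by apply/same_componentP.
have yy : same_component off_walls y y by apply/same_componentP.
split=> [[[hx hy]|[hx hy]]|].
- by move/RltP: (hx _ xx) (hy _ yy) => h /RltP h'; rewrite (gtr0_sg h) (ltr0_sg h'); lra.
- by move/RltP: (hx _ xx) (hy _ yy) => h /RltP h'; rewrite (ltr0_sg h) (gtr0_sg h'); lra.
have := off_wallsP i ox; have := off_wallsP i oy.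
rewrite neq_lt => /orP[dy|dy]; rewrite neq_lt => /orP[dx|dx].
- by rewrite (ltr0_sg dx) (ltr0_sg dy) eqxx.
- move=> _; left; split=> z hz; apply/RltP; rewrite -[IZR 0]/(@GRing.zero R).
    by rewrite -sgr_gt0 -(proj1 (@same_componentP _ z ox) hz) sgr_gt0.
  by rewrite -sgr_lt0 -(proj1 (@same_componentP _ z oy) hz) sgr_lt0.
- move=> _; right; split=> z hz; apply/RltP; rewrite -[IZR 0]/(@GRing.zero R).
    by rewrite -sgr_lt0 -(proj1 (@same_componentP _ z ox) hz) sgr_lt0.
  by rewrite -sgr_gt0 -(proj1 (@same_componentP _ z oy) hz) sgr_gt0.
- by rewrite (gtr0_sg dx) (gtr0_sg dy) eqxx.
Qed.

Lemma not_parallel j k (p q : R) : j != k -> p != 0 -> q != 0 ->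
  exists c, p * v k c - q * v j c <> 0.
Proof.
move=> njk p0 q0; have [_ [v_inj _]] := v_arr.
have [/existsP[c /eqP h]|/existsPn h] := boolP [exists c, p * v k c - q * v j c != 0]; first by exists c.
case/eqP: njk; apply: v_inj => x.
have E : p * dot (v k) x = q * dot (v j) x.
  apply/eqP; rewrite -subr_eq0 !dotE !mulr_sumr -sumrB big1 // => c _.
  by rewrite !mulrA -mulrBl; have := h c; rewrite negbK => /eqP->; rewrite mul0r.
split=> hx; apply/eqP.
  by rewrite -(mulrI_eq0 _ (mulfI p0)) E hx mulr0.
by rewrite -(mulrI_eq0 _ (mulfI q0)) -E hx mulr0.
Qed.

(** On the segment from [x] to a generic point of the chamber of [y], the wall [j] is the first one
    crossed, and [z] is taken just beyond the crossing point. *)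
Lemma gallery_step x y i : off_walls x -> off_walls y ->
  Num.sg (dot (v i) x) != Num.sg (dot (v i) y) ->
  exists z j, [/\ Num.sg (dot (v j) x) != Num.sg (dot (v j) y),
    Num.sg (dot (v j) z) = Num.sg (dot (v j) y) &
    forall k, k != j -> Num.sg (dot (v k) z) = Num.sg (dot (v k) x)].
Proof.
move=> ox oy xyi.
(* For separating walls [j != k], the vector [u (j, k)] is orthogonal to the endpoint exactly when
   both are crossed at the same time. The diagonal, where the combination would vanish, is filled
   with a wall normal. *)
pose u (jk : 'I_m * 'I_m) : point n := fun c =>
  if jk.1 == jk.2 then v jk.1 c else dot (v jk.1) x * v jk.2 c - dot (v jk.2) x * v jk.1 c.
have u0 jk : exists c, u jk c <> 0.
  rewrite /u; case: eqVneq => [_|njk]; first exact: v_neq0.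
  by apply: not_parallel; rewrite ?off_wallsP.
(* Moving [y] inside its chamber makes the crossing times [tau] distinct. *)
have [y' [yy' uy']] := generic_point v y u0.
have {}yy' k : Num.sg (dot (v k) y') = Num.sg (dot (v k) y) by apply/yy'/off_wallsP.
have y'0 k : dot (v k) y' != 0 by rewrite -sgr_eq0 yy' sgr_eq0 off_wallsP.
have x0 k := off_wallsP k ox.
pose tau k := dot (v k) x / (dot (v k) x - dot (v k) y').
pose P k := Num.sg (dot (v k) x) != Num.sg (dot (v k) y').
have Pi : P i by rewrite /P yy'.
case: (Order.TotalTheory.arg_minP tau Pi) => j Pj jmin.
have [/andP[t0 t1] sgj _] := sgr_cross (x0 j) (y'0 j) Pj.
set p := segment_pt x y' (tau j).
have pj : dot (v j) p = 0.
  rewrite dot_segment /tau; field.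
  by apply: contraTneq t0 => ->; rewrite invr0 mulr0 ltxx.
have pk k : k != j -> Num.sg (dot (v k) p) = Num.sg (dot (v k) x).
  move=> nkj; rewrite dot_segment; have [Pk|] := boolP (P k); last first.
    by rewrite negbK => /eqP Pk; apply: sgr_convex; rewrite // !ltW.
  have [/andP[tk0 tk1] _ ->//] := sgr_cross (x0 k) (y'0 k) Pk.
  rewrite ltW //= lt_neqAle jmin // andbT.
  have h (a b : R) : 0 < a / (a - b) -> a - b != 0.
    by move=> h; apply: contraTneq h => ->; rewrite invr0 mulr0 ltxx.
  apply/eqP => /eqP; rewrite /tau eqr_div ?h // => /eqP E.
  have njk : (j == k) = false by rewrite eq_sym (negbTE nkj).
  have := uy' (j, k); rewrite dotC /u /= njk => /eqP; apply.
  transitivity (dot (v j) x * dot (v k) y' - dot (v k) x * dot (v j) y').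
    by rewrite !dotE !mulr_sumr -sumrB; apply: eq_bigr => c _; ring.
  by move: E; move: (dot _ _) (dot _ _) (dot _ _) (dot _ _) => a b c d; lra.
have [d d0 dP] := dot_perturb v p (fun c => y' c - x c).
have dxy k : dot (v k) (fun c => y' c - x c) = dot (v k) y' - dot (v k) x.
  by rewrite !dotE -sumrB; apply: eq_bigr => c _; rewrite mulrBr.
exists (shift p d (fun c => y' c - x c)), j; split.
- by rewrite -yy'.
- by rewrite dot_shift pj add0r dxy sgrM gtr0_sg // mul1r sgj yy'.
move=> k nkj; rewrite dP; [exact: pk|by rewrite ltW /=|by rewrite -sgr_eq0 pk // sgr_eq0].
Qed.

(** The image of the wall [j] is some wall [l], and a linear form vanishing on it is a multiple of
    that of [v l]; the factor is nonzero because [v j] is. *)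
Lemma reflect_dual i j : exists l (k : R), k != 0 /\
  forall x, dot (v j) (reflect_in (v i) x) = k * dot (v l) x.
Proof.
have [_ [_ /(_ i j)[l hl]]] := v_arr.
have sub x : hyperplane (v l) x -> hyperplane (reflect_in (v i) (v j)) x.
  move=> /hl[y [hy xy]]; rewrite /hyperplane -dot_reflect.
  have -> : x = reflect_in (v i) y by apply: functional_extensionality.
  by rewrite reflect_inK.
have [k kP] := hyperplane_sub (v_neq0 l) sub; exists l, k.
have kP' x : dot (v j) (reflect_in (v i) x) = k * dot (v l) x by rewrite dot_reflect kP.
split=> //; apply: contraTneq (dot_gt0 (v_neq0 j)) => k0.
by rewrite -{2}(reflect_inK (v_neq0 i) (v j)) kP' k0 mul0r ltxx.
Qed.

Lemma reflect_perm i : exists s : 'I_m -> 'I_m, involutive s /\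
  forall j, exists2 k : R, k != 0 & forall x, dot (v j) (reflect_in (v i) x) = k * dot (v (s j)) x.
Proof.
have [s /fin_all_exists[k sP]] := fin_all_exists (reflect_dual i).
exists s; split=> j; last by case: (sP j) => k0 kP; exists (k j).
have [_ [v_inj _]] := v_arr; apply: v_inj => x.
have [k1 h1] := sP j; have [k2 h2] := sP (s j).
rewrite /hyperplane -{2}(reflect_inK (v_neq0 i) x) h1 h2 mulrA.
split=> [->|/eqP]; first by rewrite mulr0.
by rewrite mulf_eq0 (negbTE (mulf_neq0 k1 k2)) => /eqP.
Qed.

Lemma reflect_off i x : off_walls x -> off_walls (reflect_in (v i) x).
Proof.
move=> ox j /eqP; have [s [_ sP]] := reflect_perm i; have [k k0 ->] := sP j.
by rewrite (negbTE (mulf_neq0 k0 (off_wallsP _ ox))).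
Qed.

Lemma reflect_same_signs i x y : same_signs x y ->
  same_signs (reflect_in (v i) x) (reflect_in (v i) y).
Proof.
move=> xy j; have [s [_ sP]] := reflect_perm i; have [k k0 E] := sP j.
by rewrite !E !sgrM xy.
Qed.

Lemma dot_reflect_self i x : dot (v i) (reflect_in (v i) x) = - dot (v i) x.
Proof.
rewrite reflect_inE dot_shift (dotC x) mulNr -mulrA mulfVK ?gt_eqF ?dot_gt0 //.
by ring.
Qed.

(** The segment from [x] to [y] meets a wall only at [p], which the reflection fixes. A point near
    [p] in the chamber of [x] is reflected to a point near [p] whose sign changes at [j] only, hence
    into the chamber of [y]; reflections map chambers to chambers. *)
Lemma wall_reflect x y j : off_walls x -> off_walls y ->
  Num.sg (dot (v j) x) != Num.sg (dot (v j) y) ->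
  (forall k, k != j -> Num.sg (dot (v k) x) = Num.sg (dot (v k) y)) ->
  same_signs (reflect_in (v j) x) y.
Proof.
move=> ox oy nj eqk.
have x0 k := off_wallsP k ox; have y0 k := off_wallsP k oy.
have [/andP[t0 t1] _ _] := sgr_cross (x0 j) (y0 j) nj.
set t := (X in 0 < X) in t0; set p := segment_pt x y t.
have pj : dot (v j) p = 0.
  rewrite dot_segment /t; field.
  by apply: contraTneq t0 => h; rewrite /t h invr0 mulr0 ltxx.
have pk k : k != j -> Num.sg (dot (v k) p) = Num.sg (dot (v k) x).
  by move=> nkj; rewrite dot_segment sgr_convex ?eqk // !ltW.
have rp : reflect_in (v j) p = p.
  apply: functional_extensionality => c.
  by rewrite reflect_inE dotC pj mul0r mulr0 oppr0 /shift mul0r addr0.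
pose u : point n := fun c => x c - p c.
have [d d0 dP] := dot_perturb v p (reflect_in (v j) u).
have dotu k : dot (v k) u = dot (v k) x - dot (v k) p.
  by rewrite !dotE -sumrB; apply: eq_bigr => c _; rewrite mulrBr.
set d1 := Num.min d 1.
have d1_gt0 : 0 < d1 by rewrite lt_min d0 ltr01.
have d1d : 0 <= d1 <= d by rewrite ltW //= ge_min lexx.
have d11 : 0 <= d1 <= 1 by rewrite ltW //= ge_min lexx orbT.
have xq : same_signs x (shift p d1 u).
  move=> k; rewrite dot_shift dotu; have [->|nkj] := eqVneq k j.
    by rewrite pj subr0 add0r sgrM (gtr0_sg d1_gt0) mul1r.
  by rewrite sgr_convex ?pk.
have rq k : dot (v k) (reflect_in (v j) (shift p d1 u)) =
            dot (v k) (shift p d1 (reflect_in (v j) u)).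
  rewrite dot_shift -{2}rp !dot_reflect dot_shift //.
move=> k; rewrite (reflect_same_signs j xq) rq.
have [->|nkj] := eqVneq k j.
  rewrite dot_shift pj add0r dot_reflect_self dotu pj subr0 sgrM (gtr0_sg d1_gt0) mul1r sgrN.
  move: nj; have := x0 j; have := y0 j.
  rewrite neq_lt => /orP[h|h]; rewrite neq_lt => /orP[h'|h'].
  - by rewrite (ltr0_sg h) (ltr0_sg h') eqxx.
  - by rewrite (ltr0_sg h) (gtr0_sg h').
  - by rewrite (gtr0_sg h) (ltr0_sg h') opprK.
  - by rewrite (gtr0_sg h) (gtr0_sg h') eqxx.
rewrite dP ?pk ?eqk // -sgr_eq0 pk // sgr_eq0 //.
Qed.
End Arrangement.

(** * The mirror structure of a tope graph *)

Section TopeGraph.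
Variables (T : finType) (e : rel T) (n m : nat) (v : 'I_m -> point n) (f : T -> point n).
Hypothesis v_arr : reflection_arrangement v.
Hypothesis f_off : forall t, off_walls v (f t).
Hypothesis f_signs : forall x, off_walls v x -> exists t, same_signs v (f t) x.
Hypothesis f_inj : forall t t', same_signs v (f t) (f t') -> t = t'.

Definition sep t t' := [set i | Num.sg (dot (v i) (f t)) != Num.sg (dot (v i) (f t'))].

Hypothesis e_sep : forall t t', e t t' = (#|sep t t'| == 1%N).

Lemma sep_sym t t' : sep t t' = sep t' t.
Proof. by apply/setP => i; rewrite !inE eq_sym. Qed.

Lemma sg_flip i (x y z : point n) : off_walls v x -> off_walls v y -> off_walls v z ->
  Num.sg (dot (v i) x) != Num.sg (dot (v i) y) ->
  (Num.sg (dot (v i) z) == Num.sg (dot (v i) y)) = (Num.sg (dot (v i) z) != Num.sg (dot (v i) x)).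
Proof.
move=> /(off_wallsP i) + /(off_wallsP i) + /(off_wallsP i).
move: (dot _ _) (dot _ _) (dot _ _) => a b c a0 b0 c0.
have n1 : (-1 == 1 :> R) = false by apply: lt_eqF; lra.
by rewrite (sgr_def a) (sgr_def b) (sgr_def c) a0 b0 c0 !mulr1n;
  case: (_ < 0); case: (_ < 0); case: (_ < 0); rewrite ?expr1 ?expr0 ?eqxx ?n1 1?eq_sym ?n1.
Qed.

Lemma in_sep_trans i t t' w : (i \in sep t' w) = ((i \in sep t t') != (i \in sep t w)).
Proof.
rewrite !inE; set a := Num.sg (dot _ (f t)).
have [<-|nt] := eqVneq a; first by case: (_ != _).
rewrite eq_sym (sg_flip (@f_off t) (@f_off t') (@f_off w)) // -/a.
by rewrite eq_sym; case: (_ == _).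
Qed.

Lemma tope_edge_sym : symmetric e.
Proof. by move=> t t'; rewrite !e_sep sep_sym. Qed.

Lemma edge_uniq t t' i j : e t t' -> i \in sep t t' -> j \in sep t t' -> i = j.
Proof. by rewrite e_sep => /cards1P[l ->] /set1P-> /set1P->. Qed.

Lemma tope_step t w i : i \in sep t w -> exists t' j,
  [/\ j \in sep t w, e t t', sep t t' = [set j] & sep t' w = sep t w :\ j].
Proof.
rewrite inE => /(gallery_step v_arr (@f_off t) (@f_off w))[z [j [nj zj zk]]].
have oz : off_walls v z.
  move=> k /eqP; rewrite -sgr_eq0; have [->|/zk->] := eqVneq k j.
    by rewrite zj sgr_eq0 (negbTE (off_wallsP j (@f_off w))).
  by rewrite sgr_eq0 (negbTE (off_wallsP k (@f_off t))).
have [t' zt'] := f_signs oz; exists t', j.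
have st : sep t t' = [set j].
  apply/setP => k; rewrite !inE zt'; have [->|/zk->] := eqVneq k j; first by rewrite zj nj.
  by rewrite eqxx.
split=> //; first by rewrite inE.
  by rewrite e_sep st cards1.
apply/setP => k; rewrite !inE zt'; have [->|/zk->] := eqVneq k j; first by rewrite zj eqxx.
by [].
Qed.

Definition tope_class i t t' := e t t' && (i \in sep t t').

(** A gallery from [t] to [w] crosses only walls that separate them. An empty [A] gives
    connectedness of the graph, a singleton that of each side of a wall. *)
Lemma tope_connect (A : {set 'I_m}) t w : [disjoint A & sep t w] ->
  connect [rel x y | e x y && [disjoint A & sep x y]] t w.
Proof.
have [k] := ubnP #|sep t w|; elim: k t => // k IH t; rewrite ltnS => le dis.
have [s0|[i it]] := set_0Vmem (sep t w).
  suff -> : t = w by [].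
  by apply: f_inj => i; apply/eqP; rewrite -[_ == _]negbK; have := in_set0 i; rewrite -s0 inE => ->.
have [t' [j [jt ett' st sw]]] := tope_step it.
apply: (@connect_trans _ _ t').
  apply: connect1; rewrite /= ett' st disjoint_sym disjoints1.
  by apply/negP => jA; have := disjointFr dis jA; rewrite jt.
apply: IH; last by apply: disjointWr dis; rewrite sw subD1set.
by rewrite sw; move: le; rewrite (cardsD1 j (sep t w)) jt.
Qed.

Lemma side_connect i t w :
  connect [rel x y | e x y && ~~ tope_class i x y] t w = (i \notin sep t w).
Proof.
apply/idP/idP.
  case/connectP => p pp ->; elim: p t pp => [|x p IH] t /=; first by rewrite inE eqxx.
  rewrite /tope_class; case/andP=> /andP[etx]; rewrite etx /= => itx /IH.
  by rewrite (in_sep_trans i t) (negbTE itx); case: (i \in sep t _).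
move=> it; have := @tope_connect [set i] t w; rewrite disjoints1 it => /(_ isT).
apply: connect_sub => x y /= /andP[exy]; rewrite disjoints1 => ixy.
by apply: connect1; rewrite /= /tope_class exy ixy.
Qed.

Lemma tope_reflection i : exists r : {perm T}, [/\
   forall t, same_signs v (f (r t)) (reflect_in (v i) (f t)), involutive r &
   is_automorphism e r].
Proof.
have ex t : exists t', same_signs v (f t') (reflect_in (v i) (f t)).
  by apply: f_signs; apply: reflect_off.
have [g gP] := fin_all_exists ex.
have v_neq0 : exists c, v i c <> 0 by case: v_arr.
have gK : involutive g.
  move=> t; apply: f_inj => j; rewrite gP (reflect_same_signs v_arr i (gP t)).
  by rewrite reflect_inK.
exists (perm (inv_inj gK)); split.
- by move=> t; rewrite permE; apply: gP.
- by move=> t; rewrite !permE.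
move=> t t'; rewrite !permE !e_sep; congr (_ == _).
have [s [sK sP]] := reflect_perm v_arr i.
rewrite -[RHS](card_preimset _ (inv_inj sK)).
apply: eq_card => j; rewrite !inE !gP; have [k k0 E] := sP j.
rewrite !E !sgrM; congr (~~ _); apply: inj_eq; apply: mulfI.
by rewrite sgr_eq0.
Qed.

Lemma tope_is_mirror : mirror_graph e.
Proof.
have v_neq0 i : exists c, v i c <> 0 by case: v_arr.
(* A point off all the walls shows that there is at least one vertex. *)
have [x [_ x0]] := generic_point v (fun=> 0) v_neq0.
have [t0 _] : exists t, same_signs v (f t) x by apply: f_signs => i; apply/eqP.
split.
  split; first by exists t0.
  move=> t w; have := @tope_connect set0 t w; rewrite disjoint_sym -setI_eq0 setI0 eqxx => /(_ isT).
  by apply: connect_sub => a b /= /andP[eab _]; apply: connect1.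
exists m, tope_class; split; first by move=> i a b /andP[].
split; first by move=> i a b; rewrite /tope_class tope_edge_sym sep_sym.
split.
  move=> a b eab; move: (eab); rewrite e_sep => /cards1P[i si]; exists i.
  split; first by rewrite /tope_class eab si set11.
  by move=> j /andP[_]; rewrite si => /set1P.
move=> i; have [r [rP rK r_aut]] := tope_reflection i; exists r; split=> //.
have ir t : i \in sep t (r t).
  rewrite inE rP dot_reflect_self // sgrN -addr_eq0 -mulr2n mulrn_eq0 /= sgr_eq0.
  exact: off_wallsP.
split.
  have sw a b : tope_class i a b -> r a = b.
    case/andP=> eab iab; apply: f_inj => j; rewrite rP.
    apply: (wall_reflect v_arr) => //; first by rewrite inE in iab.
    move=> k; apply: contraNeq => nk; apply/eqP/(edge_uniq eab) => //.
    by rewrite inE.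
  move=> a b ab; split; first exact: sw.
  by apply: sw; move: ab; rewrite /tope_class tope_edge_sym sep_sym.
exists t0, (r t0); rewrite !side_connect negbK; split=> //.
have rn w : (i \in sep (r t0) w) = (i \notin sep t0 w).
  by rewrite (in_sep_trans i t0) ir; case: (i \in _).
split; first by move=> w; rewrite !side_connect rn negbK; case: (i \in _).
split.
  move=> w; rewrite side_connect rn negbK; split=> [iw|[a []]].
    exists (r w); rewrite side_connect rK; split=> //.
    by rewrite (in_sep_trans i w) sep_sym iw ir.
  by rewrite side_connect => ia <-; have := ir a; rewrite (in_sep_trans i t0) (negbTE ia); case: (i \in _).
move=> a b _ _; rewrite /= r_aut /tope_class r_aut; congr (_ && ~~ (_ && _)).
by rewrite (in_sep_trans i a) ir (in_sep_trans i b a) ir sep_sym; case: (i \in _).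
Qed.
End TopeGraph.

Theorem tope_graph_mirror (T : finType) (e : rel T) :
  tope_graph_of_reflection_arrangement e -> mirror_graph e.
Proof.
move=> [n [m [v [v_arr [f [f_off [f_ex e_ex]]]]]]].
have ox x : (forall i, dot (v i) x != 0) -> off_walls v x by move=> h i /eqP; rewrite (negbTE (h i)).
have sc t y : same_component (off_walls v) (f t) y <-> same_signs v (f t) y.
  exact: same_componentP.
have sp i t t' : separates (v i) (same_component (off_walls v) (f t))
    (same_component (off_walls v) (f t')) <-> i \in sep v f t t'.
  by rewrite inE; apply: separatesP.
apply: (@tope_is_mirror _ _ _ _ v f) => //.
- by move=> x ox'; have [t [/sc ? _]] := f_ex x ox'; exists t.
- move=> t t' tt'; have [t1 [_ t1_uniq]] := f_ex _ (f_off t').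
  have <- : t1 = t by apply: t1_uniq; apply/sc.
  by apply: t1_uniq; apply/sc.
move=> t t'; apply/idP/cards1P.
  case/e_ex => i [/sp hi i_uniq]; exists i.
  by apply/setP => j; rewrite in_set1; apply/idP/eqP => [hj|->//]; apply/i_uniq/sp.
case=> i si; apply/e_ex; exists i; split; first by apply/sp; rewrite si set11.
by move=> j /sp; rewrite si => /set1P.
Qed.

(** * Coxeter groups as reflection groups *)

Lemma gpow_mul (H : group_str) (x : H) a b : gpow x a = gone H -> gpow x (b * a)%N = gone H.
Proof.
have add c d : gpow x (c + d)%N = gmul (gpow x c) (gpow x d).
  by elim: c => [|c IH]; rewrite /= ?gmul1 // IH gmulA.
by move=> xa; elim: b => // b IH; rewrite mulSn add xa IH gmul1.
Qed.

Definition presented_by_orders (gT : finGroupType) p (s : 'I_p -> gT) :=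
  forall (H : group_str) (h : 'I_p -> H),
    (forall i j, gpow (gmul (h i) (h j)) #[s i * s j]%g = gone H) ->
    exists f : gT -> H,
      (forall x y, f (x * y)%g = gmul (f x) (f y)) /\ (forall i, f (s i) = h i).

(* The Coxeter matrix of the definition need not be symmetric and different
   indices may name the same generator; with [#[s i * s j]] in its place and
   an injective indexing, all the other properties of the presentation remain. *)
Lemma coxeter_system_normal (gT : finGroupType) m (a : 'I_m -> gT) k :
  coxeter_system a k -> exists p (s : 'I_p -> gT),
  [/\ injective s, forall i, (s i * s i = 1)%g, << [set s i | i : 'I_p] >>%g = [set: gT],
      cayley_rel a =2 cayley_rel s & presented_by_orders s].
Proof.
move=> [kii [_ [a_gen [a_rel a_univ]]]].
pose A := [set a i | i : 'I_m].
have aA i : a i \in A by apply: imset_f.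
pose s (c : 'I_#|A|) := enum_val c.
have s_a c : exists i, s c = a i by have /imsetP[i _ si] := enum_valP c; exists i.
have a_s i : exists c, a i = s c by exists (enum_rank_in (aA i) (a i)); rewrite /s enum_rankK_in.
exists #|A|, s; split.
- exact: enum_val_inj.
- by move=> c; have [i ->] := s_a c; have := a_rel i i 1%N (kii i); rewrite expg1.
- rewrite -a_gen; congr <<_>>%g; apply/setP => x; apply/imsetP/imsetP => -[i _ ->].
    by have [j ->] := s_a i; exists j.
  by have [j ->] := a_s i; exists j.
- move=> x y; apply/existsP/existsP => -[i /eqP->].
    by have [j ->] := a_s i; exists j.
  by have [j ->] := s_a i; exists j.
move=> H h h_rel; have [g gP] := fin_all_exists a_s.
have [i j n kij|f [fM fa]] := a_univ H (fun i => h (g i)).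
  have /dvdnP[d ->] : (#[s (g i) * s (g j)]%g %| n)%N.
    by rewrite order_dvdn -!gP (a_rel _ _ _ kij).
  by apply: gpow_mul; apply: h_rel.
exists f; split=> // c; have [i sc] := s_a c.
rewrite sc fa; congr h; apply: (@enum_val_inj _ A); by rewrite -/(s _) -/(s _) -gP.
Qed.

(** The group of order two, target of the sign character that gives the parity of the length. *)
Definition xor_group : group_str :=
  @GroupStr bool addb false id addbA addFb addbb.

(** * The length function *)

Section Length.
Variables (gT : finGroupType) (p : nat) (s : 'I_p -> gT).
Hypothesis s2 : forall i, (s i * s i = 1)%g.
Hypothesis s_gen : << [set s i | i : 'I_p] >>%g = [set: gT].
Hypothesis s_univ : presented_by_orders s.
Implicit Types (w g : gT) (q : seq 'I_p).

Definition wd q : gT := foldr (fun i g => (g * s i)%g) 1%g q.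

Lemma wd_cat q1 q2 : wd (q1 ++ q2) = (wd q2 * wd q1)%g.
Proof. by elim: q1 => [|i q IH] /=; rewrite ?mulg1 // IH mulgA. Qed.

Lemma wd_ex w : exists n, [exists q : n.-tuple 'I_p, wd q == w].
Proof.
have : w \in << [set s i | i : 'I_p] >>%g by rewrite s_gen inE.
case/gen_prodgP => n [c cP ->]; elim: n c cP => [|n IH] c cP.
  by exists 0%N; apply/existsP; exists [tuple]; rewrite big_ord0.
rewrite big_ord_recr /=.
have [|n' /existsP[q /eqP hq]] := IH (fun i => c (widen_ord (leqnSn n) i)); first by move=> i; apply: cP.
have /imsetP[i _ ->] := cP ord_max.
by exists n'.+1; apply/existsP; exists [tuple of i :: q]; rewrite /= hq.
Qed.

Definition len w := ex_minn (wd_ex w).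

Lemma len_word w : exists2 q, wd q = w & size q = len w.
Proof.
rewrite /len; case: ex_minnP => n /existsP[q /eqP hq] _.
by exists q; rewrite ?size_tuple.
Qed.

Lemma len_min q : (len (wd q) <= size q)%N.
Proof.
rewrite /len; case: ex_minnP => n _; apply; apply/existsP.
by exists (in_tuple q).
Qed.

Lemma len_mulS w i : (len (w * s i)%g <= (len w).+1)%N.
Proof. by have [q <- <-] := len_word w; apply: (len_min (i :: q)). Qed.

Lemma len_mul_wd w q : (len (w * wd q)%g <= len w + size q)%N.
Proof.
by have [q' <- <-] := len_word w; rewrite -wd_cat addnC -size_cat len_min.
Qed.

Lemma len_parity : exists sgn : gT -> bool, forall w i,
  odd (len w) = sgn w /\ sgn (w * s i)%g = ~~ sgn w.
Proof.
have rel (i j : 'I_p) : gpow (H := xor_group) (addb true true) #[s i * s j]%g = false by elim: #[_]%g.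
have [f [fM fs]] := s_univ (H := xor_group) (h := fun=> true) rel.
have f1 : f 1%g = false by have := fM 1%g 1%g; rewrite mulg1 /=; case: (f 1%g).
exists f => w i; split; last by rewrite fM fs /= addbT.
have [q <- <-] := len_word w; elim: q => [|j q IH] /=; first by rewrite f1.
by rewrite IH fM fs /= addbT.
Qed.

(** The two lengths differ by at most one, and the sign character forbids equality. *)
Lemma len_step w i : len (w * s i)%g = (len w).+1 \/ len w = (len (w * s i)%g).+1.
Proof.
have [sgn sgnP] := len_parity; have [o1 o2] := sgnP w i; have [o3 _] := sgnP (w * s i)%g i.
have le1 := len_mulS w i; have le2 := len_mulS (w * s i)%g i.
rewrite -mulgA s2 mulg1 in le2.
move: le1 le2; rewrite leq_eqVlt => /predU1P[|]; first by left.
rewrite ltnS => le1; rewrite leq_eqVlt => /predU1P[|]; first by right.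
rewrite ltnS => le2; have /eqP E : len w == len (w * s i)%g by rewrite eqn_leq le1 le2.
by move: o3; rewrite -E o1 o2; case: (sgn w).
Qed.

Lemma len_descent w : w != 1%g -> exists i, (len (w * s i)%g < len w)%N.
Proof.
have [q hq sq] := len_word w; case: q hq sq => [<-|i q hq sq]; first by rewrite eqxx.
move=> _; exists i; rewrite -sq -hq /= -mulgA s2 mulg1 ltnS.
exact: len_min.
Qed.

End Length.

(** * Dihedral words and the sine sequence *)

Lemma rev_alt_word (I : Type) (i j : I) n : rev (alt_word i j n.*2) = alt_word j i n.*2.
Proof.
elim: n => // n IH; rewrite doubleS [in RHS]alt_wordS [in RHS]alt_wordS /= odd_double /=.
by rewrite !rev_cons IH.
Qed.

Lemma mem_alt_word (I : eqType) (i j k : I) n : k \in alt_word i j n -> k = i \/ k = j.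
Proof. by elim: n i j => // n IH i j; rewrite inE => /predU1P[->|/IH[]->]; [left|right|left]. Qed.

Definition dihedral_cos (m : nat) : R := cos (Rdiv PI (INR m)).

Lemma dihedral_cos1 : dihedral_cos 1 = -1.
Proof. by rewrite /dihedral_cos /= Rdiv_1_r cos_PI. Qed.

(* [U k = sin (k pi / m) / sin (pi / m)] *)
Lemma dihedral_sequence (m : nat) : (1 < m)%N ->
  let c := dihedral_cos m in
  c ^+ 2 != 1 /\ exists U : nat -> R,
    [/\ U 0%N = 0, U 1%N = 1, forall k, U k.+2 = 2 * c * U k.+1 - U k,
        forall k, (k <= m)%N -> 0 <= U k & U m.*2 = 0 /\ U m.*2.+1 = 1].
Proof.
move=> m1 c; rewrite /c /dihedral_cos; set th := Rdiv PI (INR m).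
have m0 : Rlt 0 (INR m) by apply: lt_0_INR; apply/ssrnat.ltP; apply: ltnW.
have thm : Rmult (INR m) th = PI by rewrite /th RdivE RmultE mulrC mulfVK //; apply/eqP; apply: Rgt_not_eq.
have th0 : Rlt 0 th by apply: Rdiv_lt_0_compat => //; apply: PI_RGT_0.
have thP : Rlt th PI.
  rewrite -thm -{1}(Rmult_1_l th); apply: Rmult_lt_compat_r => //.
  by rewrite -INR_1; apply: lt_INR; apply/ssrnat.ltP.
have s0 : Rlt 0 (sin th) by apply: sin_gt_0.
have sn0 : sin th != 0 by apply/eqP; apply: Rgt_not_eq.
split.
  have h : sin th * sin th + cos th * cos th = 1 := sin2_cos2 th.
  apply: contraNneq sn0; rewrite expr2 => c1.
  have : sin th * sin th = 0 by move: h; rewrite c1 => /eqP; rewrite -subr_eq0 addrK => /eqP.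
  by move/eqP; rewrite mulf_eq0 orbb.
exists (fun k => sin (Rmult (INR k) th) / sin th); split.
- by rewrite Rmult_0_l sin_0 mul0r.
- by rewrite Rmult_1_l divff.
- move=> k; have -> : sin (Rmult (INR k.+2) th) =
     2 * cos th * sin (Rmult (INR k.+1) th) - sin (Rmult (INR k) th).
    have -> : Rmult (INR k.+2) th = Rplus (Rmult (INR k.+1) th) th by rewrite (S_INR k.+1) !(RplusE, RmultE) mulrDl mul1r.
    have -> : Rmult (INR k) th = Rminus (Rmult (INR k.+1) th) th by rewrite (S_INR k) !(RplusE, RmultE, RminusE) mulrDl mul1r addrK.
    by rewrite sin_plus sin_minus RminusE RplusE !RmultE; move: (sin _) (cos _) (sin _) (cos _) => a b d e; ring.
  by field.
- move=> k km; apply: divr_ge0; last by apply/RleP; apply: Rlt_le.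
  apply/RleP; apply: sin_ge_0.
    by apply: Rmult_le_pos; [apply: pos_INR|apply: Rlt_le].
  rewrite -thm; apply: Rmult_le_compat_r; first exact: Rlt_le.
  by apply: le_INR; apply/ssrnat.leP.
have E2 : Rmult (INR m.*2) th = Rmult 2 PI.
  by rewrite -addnn plus_INR Rmult_plus_distr_r thm Rplus_diag.
split; first by rewrite E2 sin_2PI mul0r.
rewrite S_INR Rmult_plus_distr_r Rmult_1_l E2 sin_plus sin_2PI cos_2PI Rmult_0_l Rplus_0_l Rmult_1_l.
by rewrite divff.
Qed.

(** The construction is transparent, so that products and powers unfold to those of matrices. *)
Definition gl_group (p : nat) : group_str.
Proof.
pose G := {M : 'M[R]_p | M \in unitmx}.
pose mul (A B : G) : G := exist _ (val A *m val B) (introT idP (eq_trans (unitmx_mul _ _) (introT andP (conj (valP A) (valP B))))).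
pose one : G := exist _ 1%:M (unitmx1 _ _).
pose inv (A : G) : G := exist _ (invmx (val A)) (eq_trans (unitmx_inv _) (valP A)).
apply: (@GroupStr G mul one inv).
- by move=> A B C; apply: val_inj; apply: mulmxA.
- by move=> A; apply: val_inj; apply: mul1mx.
- by move=> A; apply: val_inj; apply: mulVmx; apply: (valP A).
Defined.

(** * The reflection representation of Tits *)

Section TitsRepresentation.
Variables (gT : finGroupType) (p : nat) (s : 'I_p -> gT).
Hypothesis s_inj : injective s.
Hypothesis s2 : forall i, (s i * s i = 1)%g.

(** The Gram matrix of the simple roots, with entries [-cos (pi / m)] for [m] the order of the
    product; the diagonal has [m = 1] and entry 1. *)
Definition tits_form : 'M[R]_p := \matrix_(i, j) - dihedral_cos #[s i * s j]%g.
Definition simple_root (i : 'I_p) : 'cV[R]_p := delta_mx i 0.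
Definition tits_refl (i : 'I_p) : 'M[R]_p :=
  1%:M - 2 *: (simple_root i *m row i tits_form).

Lemma prod_orderC i j : #[s i * s j]%g = #[s j * s i]%g.
Proof.
have sV k : ((s k)^-1 = s k)%g by apply: (mulgI (s k)); rewrite mulgV s2.
by rewrite -orderV invMg !sV.
Qed.

Lemma prod_order_gt1 i j : i != j -> (1 < #[s i * s j]%g)%N.
Proof.
move=> nij; rewrite ltn_neqAle order_gt0 andbT eq_sym order_eq1; apply: contra nij => /eqP h.
by apply/eqP/s_inj; apply: (mulIg (s j)); rewrite h s2.
Qed.

Lemma tits_form_diag i : tits_form i i = 1.
Proof. by rewrite mxE s2 order1 dihedral_cos1 opprK. Qed.

Lemma tits_formC i j : tits_form i j = tits_form j i.
Proof. by rewrite !mxE prod_orderC. Qed.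

Lemma tits_reflE i (x : 'cV_p) :
  tits_refl i *m x = x - (2 * (tits_form *m x) i 0) *: simple_root i.
Proof.
rewrite /tits_refl mulmxBl mul1mx -scalemxAl -mulmxA -row_mul -scalerA.
by rewrite [row i _]mx11_scalar mxE mul_mx_scalar.
Qed.

Lemma tits_form_root i j : (tits_form *m simple_root j) i 0 = tits_form i j.
Proof. by rewrite -colE mxE. Qed.

Lemma tits_refl_root i j : tits_refl i *m simple_root j =
  simple_root j - (2 * tits_form i j) *: simple_root i.
Proof. by rewrite tits_reflE tits_form_root. Qed.

Lemma tits_refl_self i : tits_refl i *m simple_root i = - simple_root i.
Proof.
by rewrite tits_refl_root tits_form_diag mulr1 scaler_nat mulr2n opprD addrA subrr add0r.
Qed.

Lemma tits_reflK i : tits_refl i *m tits_refl i = 1%:M.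
Proof.
apply/matrixP => a b; have h : tits_refl i *m (tits_refl i *m simple_root b) = simple_root b.
  rewrite (tits_refl_root i b) mulmxBr -scalemxAr tits_refl_self tits_refl_root scalerN opprK.
  by rewrite subrK.
have := congr1 (fun M : 'cV_p => M a 0) h.
by rewrite mulmxA -colE !mxE andbT => ->.
Qed.

Lemma tits_refl_unit i : tits_refl i \in unitmx.
Proof. by case/mulmx1_unit: (tits_reflK i). Qed.

Definition mxword (q : seq 'I_p) : 'M[R]_p := foldr (fun i M => M *m tits_refl i) 1%:M q.

Lemma mxword_cat q1 q2 : mxword (q1 ++ q2) = mxword q2 *m mxword q1.
Proof. by elim: q1 => [|i q IH] /=; rewrite ?mulmx1 // IH mulmxA. Qed.

(** The next reflection negates its own root and adds [2 cos (pi / m)] times that root to the other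
    one, which is the recursion of [U]. *)
Lemma mxword_alt t i (U : nat -> R) k : t != i ->
  U 0%N = 0 -> U 1%N = 1 ->
  (forall k, U k.+2 = 2 * dihedral_cos #[s i * s t]%g * U k.+1 - U k) ->
  mxword (alt_word t i k) *m simple_root i =
  U k.+1 *: simple_root (if odd k then t else i) + U k *: simple_root (if odd k then i else t).
Proof.
move=> nti U0 U1 US; elim: k => [|k IH].
  by rewrite /= mul1mx U0 U1 scale1r scale0r addr0.
rewrite alt_wordS -cats1 mxword_cat /= mul1mx -mulmxA IH.
set y := if odd k then i else t; set x := if odd k then t else i.
have xy : tits_form y x = - dihedral_cos #[s i * s t]%g.
  by rewrite /y /x; case: (odd k); rewrite mxE // prod_orderC.
have -> : (if ~~ odd k then t else i) = y by rewrite /y; case: (odd k).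
have -> : (if ~~ odd k then i else t) = x by rewrite /x; case: (odd k).
rewrite mulmxDr -!scalemxAr tits_refl_self tits_refl_root xy US.
move: (simple_root x) (simple_root y) => X Y.
by apply/matrixP => a b; rewrite !mxE; ring.
Qed.

Lemma mxword_alt2 i j n :
  mxword (alt_word j i n.*2) = iter n (mulmx (tits_refl i *m tits_refl j)) 1%:M.
Proof.
have comm n' : iter n' (mulmx (tits_refl i *m tits_refl j)) 1%:M *m (tits_refl i *m tits_refl j) =
    iter n'.+1 (mulmx (tits_refl i *m tits_refl j)) 1%:M.
  by elim: n' => [|n' IH]; rewrite /= ?mul1mx ?mulmx1 // -mulmxA IH.
by elim: n => // n IH; rewrite -comm -IH /= -mulmxA.
Qed.

Lemma mxwordK q : mxword q *m mxword (rev q) = 1%:M.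
Proof.
elim: q => [|i q IH]; first by rewrite mulmx1.
by rewrite rev_cons -cats1 mxword_cat /= mul1mx mulmxA -(mulmxA (mxword q)) tits_reflK mulmx1.
Qed.

Lemma mxword_fix q x : (forall i, i \in q -> (tits_form *m x) i 0 = 0) -> mxword q *m x = x :> 'cV_p.
Proof.
elim: q => [|i q IH] h; first by rewrite mul1mx.
rewrite /= -mulmxA tits_reflE h ?mem_head // mulr0 scale0r subr0 IH //.
by move=> j jq; apply: h; rewrite inE jq orbT.
Qed.

(** The product fixes both simple roots by periodicity of the sine sequence, and every vector
    orthogonal to both. Since [c ^+ 2 != 1], the form is nondegenerate on their plane, so these
    vectors span everything. *)
Lemma tits_relation i j :
  iter #[s i * s j]%g (mulmx (tits_refl i *m tits_refl j)) 1%:M = 1%:M.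
Proof.
have [->|nij] := eqVneq i j; first by rewrite s2 order1 /= mulmx1 tits_reflK.
have nji : j != i by rewrite eq_sym.
rewrite -mxword_alt2; set m := #[_]%g; set c := dihedral_cos m.
have [c1 [U [U0 U1 US _ [Um Um1]]]] := dihedral_sequence (prod_order_gt1 nij).
rewrite -/m -/c in c1 US Um Um1.
have fi : mxword (alt_word j i m.*2) *m simple_root i = simple_root i.
  by rewrite (mxword_alt _ nji U0 U1) // odd_double Um Um1 scale1r scale0r addr0.
have fj : mxword (alt_word j i m.*2) *m simple_root j = simple_root j.
  have US' k : U k.+2 = 2 * dihedral_cos #[s j * s i]%g * U k.+1 - U k by rewrite prod_orderC US.
  have := mxword_alt m.*2 nij U0 U1 US'.
  rewrite odd_double Um Um1 scale1r scale0r addr0 => {1}<-; rewrite mulmxA.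
  have -> : alt_word i j m.*2 = rev (alt_word j i m.*2).
    by rewrite rev_alt_word.
  by rewrite mxwordK mul1mx.
have fx (x : 'cV_p) : mxword (alt_word j i m.*2) *m x = x.
  set a := (tits_form *m x) i 0; set b := (tits_form *m x) j 0.
  have d0 : 1 - c ^+ 2 != 0 by rewrite subr_eq0 eq_sym.
  (* The solution of the two linear equations saying that [x0] is orthogonal to both roots. *)
  set l := (a + c * b) / (1 - c ^+ 2); set u := (b + c * a) / (1 - c ^+ 2).
  set x0 := x - l *: simple_root i - u *: simple_root j.
  have fijE : tits_form i j = - c by rewrite mxE.
  have fjiE : tits_form j i = - c by rewrite tits_formC.
  have B0 k : (tits_form *m x0) k 0 = (tits_form *m x) k 0 - l * tits_form k i - u * tits_form k j.
    rewrite !mulmxBr -!scalemxAr -!tits_form_root.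
    by move: (_ *m _) (_ *m _) (_ *m _) => X Y Z; rewrite !mxE.
  have xE : x = x0 + (l *: simple_root i + u *: simple_root j).
    by rewrite /x0 -[x - _ - _]addrA -opprD subrK.
  clearbody x0; rewrite [in LHS]xE [in RHS]xE.
  rewrite !mulmxDr -!scalemxAr fi fj mxword_fix // => k /mem_alt_word[->|->].
    by rewrite B0 tits_form_diag fjiE -/b /l /u; field.
  by rewrite B0 tits_form_diag fijE -/a /l /u; field.
apply/matrixP => a b; have := congr1 (fun M : 'cV_p => M a 0) (fx (simple_root b)).
by rewrite /simple_root -colE !mxE andbT.
Qed.

Hypothesis s_univ : presented_by_orders s.

Lemma tits_rep : exists rho : gT -> 'M[R]_p,
  [/\ rho 1%g = 1%:M, forall x y, rho (x * y)%g = rho x *m rho y & forall i, rho (s i) = tits_refl i].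
Proof.
pose h i : gl_group p := exist _ (tits_refl i) (tits_refl_unit i).
have valpow (x : gl_group p) n : val (gpow x n) = iter n (mulmx (val x)) 1%:M.
  by elim: n => //= n <-.
have [i j|f [fM fs]] := s_univ (h := h).
  by apply: val_inj; rewrite valpow; apply: tits_relation.
have rM x y : val (f (x * y)%g) = val (f x) *m val (f y) by rewrite fM.
exists (fun g => val (f g)); split=> // [|i]; last by rewrite fs.
have := rM 1%g 1%g; rewrite mulg1 => /(congr1 (mulmx (invmx (val (f 1%g))))).
by rewrite mulmxA mulVmx ?(valP (f 1%g)) // mul1mx => <-.
Qed.
End TitsRepresentation.

(** * Roots and their signs *)

Section Roots.
Variables (gT : finGroupType) (p : nat) (s : 'I_p -> gT) (rho : gT -> 'M[R]_p).
Hypothesis s_inj : injective s.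
Hypothesis s2 : forall i, (s i * s i = 1)%g.
Hypothesis s_gen : << [set s i | i : 'I_p] >>%g = [set: gT].
Hypothesis s_univ : presented_by_orders s.
Hypothesis rho1 : rho 1%g = 1%:M.
Hypothesis rhoM : forall x y, rho (x * y)%g = rho x *m rho y.
Hypothesis rho_s : forall i, rho (s i) = tits_refl s i.

Local Notation alpha := (@simple_root p).
Local Notation wd := (wd s).
Local Notation len := (len s_gen).
Local Notation Bf := (tits_form s).
Implicit Types (w g : gT) (x y : 'cV[R]_p).

Lemma rho_wd q : rho (wd q) = mxword s q.
Proof. by elim: q => [|i q IH] //=; rewrite rhoM IH rho_s. Qed.

Lemma rhoK g x : rho g^-1%g *m (rho g *m x) = x.
Proof. by rewrite mulmxA -rhoM mulVg rho1 mul1mx. Qed.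

Lemma rhoVK g x : rho g *m (rho g^-1%g *m x) = x.
Proof. by rewrite mulmxA -rhoM mulgV rho1 mul1mx. Qed.

Definition nneg x := forall c, 0 <= x c 0.

(** By the braid relation, the first [m] letters, which are the rightmost factors, may begin with
    either generator. *)
Lemma wd_alt_order i j k : wd (alt_word i j (k + #[s i * s j]%g)) =
  (wd (if odd #[s i * s j]%g then alt_word j i k else alt_word i j k) * wd (alt_word j i #[s i * s j]%g))%g.
Proof.
set m := #[_]%g; rewrite addnC alt_word_add wd_cat; congr (_ * _)%g.
have alt2 a b n : wd (alt_word a b n.*2) = ((s b * s a) ^+ n)%g.
  by elim: n => //= n IH; rewrite IH -mulgA expgSr.
have anti q c a b : wd (alt_word a b m.*2) = 1%g -> wd (alt_word b a m.*2) = 1%g -> (c + q = m.*2)%N ->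
    wd (alt_word a b c) = wd (alt_word b a q).
  elim: q c a b => [|q IH] c a b h1 h2; first by rewrite addn0 => ->.
  rewrite addnS -addSn => /(IH _ b a h2 h1) /= <-.
  by rewrite -mulgA s2 mulg1.
apply: anti; rewrite ?addnn // alt2; last exact: expg_order.
by rewrite /m (prod_orderC s2) expg_order.
Qed.

(* Write [w = v * d] with [d] the longest possible alternating suffix in [t] and
   [i], where [t] is a descent of [w]; then [v] has neither of them as a descent
   and [rho d] maps [alpha i] to a nonnegative combination of the two roots. *)
Lemma root_pos w i : (len w < len (w * s i)%g)%N -> nneg (rho w *m alpha i).
Proof.
have [n] := ubnP (len w); elim: n w i => // n IH w i; rewrite ltnS => wn lt.
have [->|w1] := eqVneq w 1%g.
  by move=> c; rewrite rho1 mul1mx mxE; case: (_ && _).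
have [t wt] := len_descent s2 s_gen w1.
have nti : t != i by apply: contraTneq lt => <-; rewrite -leqNgt ltnW.
pose P k := [exists v, (w == v * wd (alt_word t i k))%g && (len w == len v + k)%N].
have P1 : P 1%N.
  apply/existsP; exists (w * s t)%g; rewrite /= mul1g -mulgA s2 mulg1 eqxx /= addn1.
  by case: (len_step s2 s_gen s_univ w t) wt => -> //; rewrite ltnNge leqnSn.
have Pub k : P k -> (k <= len w)%N by case/existsP => v /andP[_ /eqP->]; apply: leq_addl.
case: (ex_maxnP (ex_intro _ 1%N P1) Pub) => k /existsP[v /andP[/eqP wE /eqP lw]] kmax.
have k0 := kmax _ P1.
set x := if odd k then t else i; set y := if odd k then i else t.
have lv : (len v < len w)%N by rewrite lw -addn1 leq_add2l.
have vy : (len v < len (v * s y)%g)%N.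
  case: (len_step s2 s_gen s_univ v y) => [->//|vyE]; exfalso.
  have /negP := ltnn k; apply; apply: kmax; apply/existsP; exists (v * s y)%g.
  rewrite alt_wordS -/y -cats1 wd_cat /= mul1g mulgA -(mulgA v) s2 mulg1 -wE eqxx /=.
  by rewrite lw vyE addSnnS.
have vx : (len v < len (v * s x)%g)%N.
  case: (len_step s2 s_gen s_univ v x) => [->//|vxE]; exfalso.
  have wE' : w = (v * s x * wd (alt_word t i k.-1))%g.
    rewrite wE -{1}(prednK k0) alt_wordS -cats1 wd_cat /= mul1g.
    have -> : (if odd k.-1 then i else t) = x by rewrite /x -(prednK k0) /=; case: (odd _).
    by rewrite mulgA.
  have := len_mul_wd s_gen (v * s x)%g (alt_word t i k.-1).
  rewrite -wE' size_alt_word lw vxE leqNgt => /negP; apply.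
  by rewrite addSn ltnS leq_add2l leq_pred.
(* Otherwise the braid relation would make [i] a descent of [w]. This bound ensures that [U k] and
   [U k.+1] are both nonnegative. *)
have km : (k < #[s t * s i]%g)%N.
  rewrite ltnNge; apply/negP => mk; set m := #[_]%g in mk.
  have m0 : (0 < m)%N by apply: order_gt0.
  set l := (if odd m then alt_word i t (k - m) else alt_word t i (k - m)).
  have wsE : (w * s i)%g = (v * wd (alt_word t i m.-1 ++ l))%g.
    rewrite wE -(subnK mk) wd_alt_order -/m -/l wd_cat -!mulgA; congr (_ * (_ * _))%g.
    by rewrite -(prednK m0) /= -mulgA s2 mulg1.
  have := len_mul_wd s_gen v (alt_word t i m.-1 ++ l).
  have sl : size l = (k - m)%N by rewrite /l; case: (odd m); rewrite size_alt_word.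
  rewrite -wsE size_cat size_alt_word sl => le.
  have : (len (w * s i)%g < len w)%N.
    apply: leq_ltn_trans le _; rewrite lw ltn_add2l -{2}(subnKC mk) ltn_add2r.
    by rewrite ltn_predL.
  by rewrite ltnNge (ltnW lt).
have [c1 [U [U0 U1 US Upos _]]] := dihedral_sequence (prod_order_gt1 s_inj s2 nti).
have -> : rho w *m alpha i = U k.+1 *: (rho v *m alpha x) + U k *: (rho v *m alpha y).
  rewrite wE rhoM rho_wd -mulmxA (mxword_alt s2 k nti U0 U1) ?mulmxDr ?scalemxAr //.
  by move=> k'; rewrite (prod_orderC s2) US.
move=> c; rewrite mxE [X in X + _]mxE [X in _ + X]mxE addr_ge0 // mulr_ge0 ?(Upos _ km) ?(Upos _ (ltnW km)) //.
  by apply: (IH v x) => //; apply: leq_trans lv wn.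
by apply: (IH v y) => //; apply: leq_trans lv wn.
Qed.

Lemma rho_mul_s w i : rho (w * s i)%g *m alpha i = - (rho w *m alpha i).
Proof. by rewrite rhoM rho_s -mulmxA tits_refl_self // mulmxN. Qed.

Lemma root_neg w i : (len (w * s i)%g < len w)%N -> nneg (- (rho w *m alpha i)).
Proof. by move=> h; rewrite -rho_mul_s; apply: root_pos; rewrite -mulgA s2 mulg1. Qed.

Definition is_root x := exists w i, x = rho w *m alpha i.

Lemma root_sign x : is_root x -> nneg x \/ nneg (- x).
Proof.
case=> w [i ->]; have [h|h] := len_step s2 s_gen s_univ w i.
  by left; apply: root_pos; rewrite h.
by right; apply: root_neg; rewrite h.
Qed.

Lemma root_rho g x : is_root x -> is_root (rho g *m x).
Proof. by case=> w [i ->]; exists (g * w)%g, i; rewrite rhoM mulmxA. Qed.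

Lemma root_opp x : is_root x -> is_root (- x).
Proof. by case=> w [i ->]; exists (w * s i)%g, i; rewrite rho_mul_s. Qed.

Lemma root_simple i : is_root (alpha i).
Proof. by exists 1%g, i; rewrite rho1 mul1mx. Qed.

Definition bform x y : R := (x^T *m Bf *m y) 0 0.

Lemma bform_rho g x y : bform (rho g *m x) (rho g *m y) = bform x y.
Proof.
suff h : (rho g)^T *m Bf *m rho g = Bf.
  by rewrite /bform -[in RHS]h trmx_mul !mulmxA.
have [q <- _] := len_word s_gen g.
have BfT : Bf^T = Bf by apply/matrixP => a b; rewrite mxE tits_formC.
have gen i : (tits_refl s i)^T *m Bf *m tits_refl s i = Bf.
  have trBZ (A C : 'M[R]_p) k : (A - k *: C)^T = A^T - k *: C^T.
    by apply/matrixP => a b; rewrite !mxE.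
  have BR : Bf *m tits_refl s i = (tits_refl s i)^T *m Bf.
    rewrite /tits_refl mulmxBr mulmx1 -scalemxAr mulmxA -colE.
    rewrite trBZ trmx_mul trmx1 mulmxBl mul1mx -scalemxAl -mulmxA tr_row BfT.
    by rewrite trmx_delta -rowE.
  by rewrite -mulmxA BR mulmxA -trmx_mul tits_reflK // trmx1 mul1mx.
elim: q => [|i q IH] /=; first by rewrite rho1 trmx1 mul1mx mulmx1.
rewrite rhoM rho_s trmx_mul -[RHS](gen i) -[in RHS]IH !mulmxA.
by [].
Qed.

Lemma bform_root x : is_root x -> bform x x = 1.
Proof.
case=> w [i ->]; rewrite bform_rho /bform -mulmxA -colE trmx_delta -rowE mxE mxE.
exact: tits_form_diag.
Qed.

Lemma root_scale x k : is_root x -> is_root (k *: x) -> k ^+ 2 = 1.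
Proof.
move=> /bform_root bx /bform_root; rewrite /bform.
have -> : (k *: x)^T = k *: x^T by apply/matrixP => a b; rewrite !mxE.
by rewrite -!scalemxAl -scalemxAr mxE [X in _ * X]mxE -/(bform x x) bx mulr1.
Qed.

(** The coordinates of a root all have the same sign, so the sign of their sum tells positive roots
    from negative ones. *)
Definition ht x : R := \sum_c x c 0.

Lemma root_neq0 x : is_root x -> x != 0.
Proof.
by move=> /bform_root; apply: contra_eqN => /eqP->; rewrite /bform mulmx0 mxE eq_sym oner_eq0.
Qed.

Lemma htN x : ht (- x) = - ht x.
Proof. by rewrite /ht -sumrN; apply: eq_bigr => c _; rewrite mxE. Qed.

Lemma nneg_ht x : nneg x -> x != 0 -> 0 < ht x.
Proof.
move=> x0 nx; rewrite lt_def sumr_ge0 // andbT; apply: contra nx.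
rewrite psumr_eq0 // => /allP h; apply/eqP/matrixP => c d; rewrite mxE ord1.
by apply/eqP/h; rewrite mem_index_enum.
Qed.

Lemma root_ht x : is_root x -> 0 < ht x <-> nneg x.
Proof.
move=> rx; split=> [h|/nneg_ht]; last by apply; apply: root_neq0.
case: (root_sign rx) => // nx.
have := nneg_ht nx; rewrite oppr_eq0 root_neq0 // htN oppr_gt0 => /(_ isT).
by rewrite ltNge ltW.
Qed.

Lemma root_ht_neq0 x : is_root x -> ht x != 0.
Proof.
move=> rx; case: (root_sign rx) => /nneg_ht; first by rewrite root_neq0 // => /(_ isT)/gt_eqF->.
by rewrite oppr_eq0 root_neq0 // htN oppr_gt0 => /(_ isT)/lt_eqF->.
Qed.

(** * Equivariant embedding into Euclidean space *)

Definition emb x : point #|{: gT * 'I_p}| :=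
  fun c => (rho (enum_val c).1 *m x) (enum_val c).2 0.

Definition chamber_pt w : point #|{: gT * 'I_p}| :=
  fun c => if (enum_val c).1 == w then 1 : R else 0 : R.

Lemma sum_enum_val (F : gT * 'I_p -> R) :
  \sum_(c < #|{: gT * 'I_p}|) F (enum_val c) = \sum_w \sum_i F (w, i).
Proof.
rewrite pair_bigA /= (reindex (@enum_val _ {: gT * 'I_p})) /=; last exact: onW_bij (enum_val_bij _).
by apply: eq_bigr => c _; rewrite -surjective_pairing.
Qed.

Lemma emb_lin x k y c : emb (x - k *: y) c = emb x c - k * emb y c.
Proof. by rewrite /emb mulmxBr -scalemxAr; move: (_ *m x) (_ *m y) => X Y; rewrite !mxE. Qed.

Lemma embN x c : emb (- x) c = - emb x c.
Proof. by rewrite /emb mulmxN; move: (_ *m x) => X; rewrite mxE. Qed.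

Lemma dot_emb_lin x k y z : dot (emb (x - k *: y)) z = dot (emb x) z - k * dot (emb y) z.
Proof.
rewrite !dotE mulr_sumr -sumrB; apply: eq_bigr => c _.
by rewrite emb_lin mulrBl mulrA.
Qed.

Lemma dot_embN x z : dot (emb (- x)) z = - dot (emb x) z.
Proof. by rewrite !dotE -sumrN; apply: eq_bigr => c _; rewrite embN mulNr. Qed.

Lemma dot_emb_sum g x z :
  dot (emb (rho g *m x)) z = \sum_a x a 0 * dot (emb (rho g *m alpha a)) z.
Proof.
rewrite dotE; under [RHS]eq_bigr => a _ do rewrite dotE mulr_sumr.
rewrite exchange_big; apply: eq_bigr => c _.
rewrite /emb mulmxA mxE mulr_suml; apply: eq_bigr => a _.
rewrite mulmxA -colE [col _ _ _ _]mxE mulrA; congr (_ * _).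
by rewrite mulrC.
Qed.

(** The dot product sums over one block for each group element, and [g] only permutes the blocks. *)
Lemma dot_emb_rho g x y : dot (emb (rho g *m x)) (emb (rho g *m y)) = dot (emb x) (emb y).
Proof.
rewrite !dotE (sum_enum_val (fun u => (rho u.1 *m (rho g *m x)) u.2 0 * (rho u.1 *m (rho g *m y)) u.2 0)).
rewrite (sum_enum_val (fun u => (rho u.1 *m x) u.2 0 * (rho u.1 *m y) u.2 0)).
rewrite [RHS](reindex_inj (mulIg g)) /=; apply: eq_bigr => w _; apply: eq_bigr => i _.
by rewrite !rhoM !mulmxA.
Qed.

Lemma dot_emb_pt x w : dot (emb x) (chamber_pt w) = ht (rho w *m x).
Proof.
rewrite dotE (sum_enum_val (fun u => (rho u.1 *m x) u.2 0 * (if u.1 == w then 1 else 0))).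
rewrite (bigD1 w) //= [X in _ + X]big1 ?addr0 => [|u /negbTE->]; last first.
  by rewrite big1 // => i _; rewrite mulr0.
by apply: eq_bigr => i _; rewrite eqxx mulr1.
Qed.

Lemma emb_eq0 x : dot (emb x) (emb x) = 0 -> x = 0.
Proof.
move=> /dot_eq0 h; apply/matrixP => i j; rewrite ord1 [RHS]mxE.
by have := h (enum_rank (1%g, i)); rewrite /emb enum_rankK rho1 mul1mx.
Qed.

Lemma emb_root_neq0 x : is_root x -> exists c, emb x c <> 0.
Proof.
move=> rx; have [/existsP[c /eqP h]|/existsPn h] := boolP [exists c, emb x c != 0]; first by exists c.
have /eqP := root_neq0 rx; case; apply: emb_eq0.
by rewrite dotE big1 // => c _; have /negPn/eqP-> := h c; rewrite mul0r.
Qed.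

(** For [b = rho w *m alpha a], the conjugate of [s a] by [w] sends [b] to [- b] and [x] to
    [x - k *: b]; as it acts isometrically, [k] must be the coefficient of the Euclidean
    reflection. *)
Lemma reflect_emb b x : is_root b -> exists g,
  reflect_in (emb b) (emb x) = emb (rho g *m x).
Proof.
move=> rb; have db := dot_gt0 (emb_root_neq0 rb); case: rb db => w [a bE] db.
exists (w * s a * w^-1)%g; set k := 2 * (Bf *m (rho w^-1%g *m x)) a 0.
have gx : rho (w * s a * w^-1)%g *m x = x - k *: b.
  rewrite !rhoM -!mulmxA rho_s tits_reflE -/k mulmxBr -scalemxAr -bE.
  by rewrite mulmxA -rhoM mulgV rho1 mul1mx.
have gb : rho (w * s a * w^-1)%g *m b = - b.
  by rewrite bE !rhoM -!mulmxA rhoK rho_s tits_refl_self // mulmxN.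
have := dot_emb_rho (w * s a * w^-1)%g b x; rewrite gb dot_embN gx (dotC (emb b) (emb (_ - _))) dot_emb_lin => D.
have kE : k = 2 * (dot (emb x) (emb b) / dot (emb b) (emb b)).
  have nz : dot (emb b) (emb b) != 0 by rewrite gt_eqF.
  apply: (mulIf nz); rewrite -[RHS]mulrA mulfVK //; move: D; rewrite (dotC (emb b) (emb x)).
  by move: (dot _ _) (dot _ _) => A C; lra.
apply: functional_extensionality => c.
by rewrite reflect_inE emb_lin kE /shift mulNr.
Qed.

(** * The arrangement of the positive roots *)

Definition pos_roots := undup [seq x <- [seq rho wi.1 *m alpha wi.2 | wi <- enum {: gT * 'I_p}] | 0 < ht x].

Lemma pos_rootsP x : reflect (is_root x /\ 0 < ht x) (x \in pos_roots).
Proof.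
rewrite mem_undup mem_filter andbC; apply: (iffP andP) => [[/mapP[[w i] _ ->] h]|[[w [i ->]] h]].
  by split=> //; exists w, i.
by split=> //; apply/mapP; exists (w, i); rewrite ?mem_enum.
Qed.

Lemma root_cases x : is_root x -> x \in pos_roots \/ - x \in pos_roots.
Proof.
move=> rx; have := root_ht_neq0 rx; rewrite neq_lt => /orP[h|h].
  by right; apply/pos_rootsP; split; [apply: root_opp|rewrite htN oppr_gt0].
by left; apply/pos_rootsP.
Qed.

Definition root_normal (k : 'I_(size pos_roots)) := emb (nth 0 pos_roots k).

Lemma nth_pos_root (k : 'I_(size pos_roots)) : nth 0 pos_roots k \in pos_roots.
Proof. exact: mem_nth. Qed.

Lemma pos_root_nth x : x \in pos_roots -> exists k : 'I_(size pos_roots), x = nth 0 pos_roots k.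
Proof.
move=> xP; have h : (index x pos_roots < size pos_roots)%N by rewrite index_mem.
by exists (Ordinal h); rewrite nth_index.
Qed.

(** Proportional roots have ratio 1 or -1, and positivity leaves 1, so the hyperplanes are distinct.
    A reflection acts as a group element, which permutes the roots up to sign. *)
Lemma root_arrangement : reflection_arrangement root_normal.
Proof.
have rt k := proj1 (elimT (pos_rootsP _) (nth_pos_root k)).
have pt k := proj2 (elimT (pos_rootsP _) (nth_pos_root k)).
split; first by move=> k; apply: emb_root_neq0.
split.
  move=> i j ij; have [k hk] := hyperplane_sub (emb_root_neq0 (rt i)) (fun z => proj1 (ij z)).
  have E : nth 0 pos_roots j = k *: nth 0 pos_roots i.
    apply/eqP; rewrite -subr_eq0; apply/eqP/emb_eq0.
    by rewrite dot_emb_lin hk subrr.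
  have k2 : k ^+ 2 = 1 by apply: (root_scale (rt i)); rewrite -E.
  have htE : ht (nth 0 pos_roots j) = k * ht (nth 0 pos_roots i).
    by rewrite E /ht mulr_sumr; apply: eq_bigr => c _; rewrite mxE.
  have k0 : 0 < k by have := pt j; rewrite htE pmulr_lgt0.
  have k1 : k = 1.
    by apply/eqP; rewrite -(eqrXn2 (n := 2)) ?ltW // expr1n k2.
  apply/val_inj/eqP; rewrite /= -(nth_uniq 0 (ltn_ord i) (ltn_ord j) (undup_uniq _)).
  by rewrite -/pos_roots E k1 scale1r.
move=> i j; have [g hg] := reflect_emb (nth 0 pos_roots j) (rt i).
have [l hl] : exists l, forall z, hyperplane (root_normal l) z <-> dot (emb (rho g *m nth 0 pos_roots j)) z = 0.
  have [/pos_root_nth[l hl]|/pos_root_nth[l hl]] := root_cases (root_rho g (rt j)); exists l => z.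
    by rewrite /hyperplane /root_normal -hl.
  rewrite /hyperplane /root_normal -hl dot_embN; split=> [/eqP|->]; last by rewrite oppr0.
  by rewrite oppr_eq0 => /eqP.
exists l => x; rewrite hl -hg -dot_reflect; split=> [hx|[y [hy xy]]].
  exists (reflect_in (root_normal i) x); split=> // c.
  by rewrite reflect_inK //; apply: emb_root_neq0.
have -> : x = reflect_in (emb (nth 0 pos_roots i)) y by apply: functional_extensionality.
by rewrite reflect_inK //; apply: emb_root_neq0.
Qed.

(** * Chambers and group elements *)

Lemma root_pos_len w i : 0 < ht (rho w *m alpha i) -> (len w < len (w * s i)%g)%N.
Proof.
move=> h; have [->//|E] := len_step s2 s_gen s_univ w i.
have n : nneg (- (rho w *m alpha i)) by apply: root_neg; rewrite E.
have r : is_root (rho w *m alpha i) by exists w, i.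
have := nneg_ht n; rewrite oppr_eq0 root_neq0 // htN => /(_ isT).
by rewrite oppr_gt0 ltNge ltW.
Qed.

Lemma simple_pos_eq1 w : (forall i, 0 < ht (rho w *m alpha i)) -> w = 1%g.
Proof.
move=> h; apply/eqP; apply: contraT => /(len_descent s2 s_gen)[i].
by rewrite ltnNge ltnW // root_pos_len.
Qed.

Lemma simple_pos i : alpha i \in pos_roots.
Proof.
apply/pos_rootsP; split; first exact: root_simple.
apply: nneg_ht; last by apply: root_neq0; apply: root_simple.
by move=> c; rewrite mxE; case: (_ && _).
Qed.

(** The reflection alters only the coordinate [i]. A positive root made negative thus has all other
    coordinates zero, and its norm makes it [alpha i]. *)
Lemma refl_pos_roots i x : x \in pos_roots -> x != alpha i -> tits_refl s i *m x \in pos_roots.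
Proof.
move=> /pos_rootsP[rx hx] nx.
have rs : is_root (tits_refl s i *m x) by rewrite -rho_s; apply: root_rho.
apply/pos_rootsP; split=> //; apply/(root_ht rs).
case: (root_sign rs) => // n; exfalso.
have xp := proj1 (root_ht rx) hx.
have x0 c : c != i -> x c 0 = 0.
  move=> nci; apply/eqP; rewrite eq_le xp andbT; have := n c.
  rewrite tits_reflE; move: (Bf *m x) => y; rewrite !mxE (negbTE nci) mulr0 oppr0 addr0.
  by rewrite oppr_ge0.
have E : x = x i 0 *: alpha i.
  apply/matrixP => c d; rewrite ord1 !mxE andbT; have [->|nci] := eqVneq c i; first by rewrite mulr1.
  by rewrite x0 // mulr0.
have k2 : (x i 0) ^+ 2 = 1 by apply: (root_scale (root_simple i)); rewrite -E.
have k1 : x i 0 = 1 by apply/eqP; rewrite -(eqrXn2 (n := 2)) ?xp // expr1n k2.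
by move: nx; rewrite {1}E k1 scale1r eqxx.
Qed.

Lemma refl_refl i x : tits_refl s i *m (tits_refl s i *m x) = x.
Proof. by rewrite mulmxA tits_reflK // mul1mx. Qed.

(* Maximise over the orbit the value of [z] on the sum of the positive roots. *)
Lemma chamber_ex z : off_walls root_normal z ->
  exists w, same_signs root_normal (chamber_pt w) z.
Proof.
move=> oz.
have z0 x : is_root x -> dot (emb x) z != 0.
  move=> /root_cases[/pos_root_nth[k ->]|/pos_root_nth[k hk]]; first exact: (off_wallsP k oz).
  by rewrite -oppr_eq0 -dot_embN hk; apply: (off_wallsP k oz).
pose psi w := \sum_(x <- pos_roots) dot (emb (rho w^-1%g *m x)) z.
have [w _ wmax] := Order.TotalTheory.arg_maxP psi (isT : xpredT 1%g).
exists w.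
(* The reflection [s i] permutes the positive roots other than [alpha i]. Passing from [w] to
   [s i * w] thus only changes the sign of the term of [alpha i], which maximality forces to be
   nonnegative. *)
have simple i : 0 < dot (emb (rho w^-1%g *m alpha i)) z.
  rewrite lt_def z0; last by apply: root_rho; apply: root_simple.
  have := wmax (s i * w)%g isT; rewrite /psi /= (big_rem _ (simple_pos i)) [X in _ <= X](big_rem _ (simple_pos i)) /=.
  have sE x : rho (s i * w)^-1%g *m x = rho w^-1%g *m (tits_refl s i *m x).
    rewrite invMg rhoM -mulmxA -rho_s; congr (_ *m (rho _ *m _)).
    by apply: (mulgI (s i)); rewrite mulgV s2.
  under eq_bigr => x _ do rewrite sE.
  rewrite sE tits_refl_self // mulmxN dot_embN.
  have perm : perm_eq (map (mulmx (tits_refl s i)) (rem (alpha i) pos_roots)) (rem (alpha i) pos_roots).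
    have ur : uniq (rem (alpha i) pos_roots) by rewrite rem_uniq ?undup_uniq.
    have inj : injective (mulmx (tits_refl s i) : 'cV_p -> 'cV_p) by apply: (can_inj (refl_refl i)).
    have mr x : (x \in rem (alpha i) pos_roots) = (x != alpha i) && (x \in pos_roots).
      by rewrite (mem_rem_uniq _ (undup_uniq _)) inE.
    have im x : x \in rem (alpha i) pos_roots -> tits_refl s i *m x \in rem (alpha i) pos_roots.
      rewrite !mr => /andP[nx xP]; rewrite refl_pos_roots // andbT.
      apply: contraTneq xP => E; rewrite -(refl_refl i x) E tits_refl_self //.
      apply/negP => /pos_rootsP[_]; have /pos_rootsP[_ h] := simple_pos i.
      by rewrite htN oppr_gt0 ltNge ltW.
    apply: uniq_perm => //; first by rewrite map_inj_uniq.
    move=> x; apply/mapP/idP => [[y yP ->]|xP]; first exact: im.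
    by exists (tits_refl s i *m x); rewrite ?refl_refl ?im.
  have -> : \sum_(x <- rem (alpha i) pos_roots) dot (emb (rho w^-1%g *m (tits_refl s i *m x))) z =
            \sum_(x <- rem (alpha i) pos_roots) dot (emb (rho w^-1%g *m x)) z.
    by rewrite -[RHS](perm_big _ perm) /= big_map.
  by move: (dot _ _) (\sum_(_ <- _) _) => A C; lra.
move=> k; have [rk hk] := elimT (pos_rootsP _) (nth_pos_root k).
rewrite /root_normal dot_emb_pt; set x := nth 0 pos_roots k in rk hk *.
have rwx := root_rho w rk.
(* A positive root is a nonnegative combination of simple ones, on whose images [z] is positive;
   [z0] makes the inequality strict. *)
have sum_pos y : is_root y -> nneg y -> 0 < dot (emb (rho w^-1%g *m y)) z.
  move=> ry ny; rewrite lt_def z0; last exact: root_rho.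
  by rewrite dot_emb_sum sumr_ge0 // => a _; rewrite mulr_ge0 // ltW.
have xE : x = rho w^-1%g *m (rho w *m x) by rewrite rhoK.
case: (root_sign rwx) => n.
  have h := proj2 (root_ht rwx) n.
  by rewrite (gtr0_sg h) gtr0_sg // xE sum_pos.
have h : ht (rho w *m x) < 0 by rewrite -oppr_gt0 -htN; apply/root_ht => //; apply: root_opp.
have := sum_pos _ (root_opp rwx) n; rewrite mulmxN dot_embN -xE oppr_gt0 => h'.
by rewrite (ltr0_sg h) ltr0_sg.
Qed.

Lemma same_signs_root w w' x : same_signs root_normal (chamber_pt w) (chamber_pt w') ->
  is_root x -> Num.sg (ht (rho w *m x)) = Num.sg (ht (rho w' *m x)).
Proof.
move=> ww' /root_cases[/pos_root_nth[k ->]|/pos_root_nth[k hk]].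
  by have := ww' k; rewrite /root_normal !dot_emb_pt.
apply: oppr_inj; rewrite -!sgrN -!htN -!mulmxN hk.
by have := ww' k; rewrite /root_normal !dot_emb_pt.
Qed.

(** Equality of all signs means that [w' * w^-1] keeps every simple root positive. *)
Lemma chamber_inj w w' : same_signs root_normal (chamber_pt w) (chamber_pt w') -> w = w'.
Proof.
move=> ww'; have : (w' * w^-1)%g = 1%g.
  apply: simple_pos_eq1 => i; have := same_signs_root ww' (root_rho w^-1%g (root_simple i)).
  rewrite rhoVK mulmxA -rhoM; have /pos_rootsP[_ h] := simple_pos i.
  by rewrite (gtr0_sg h) => /esym; rewrite -[0 < _]sgr_gt0 => ->; rewrite ltr01.
by move=> h; rewrite -(mulgKV w w') h mul1g.
Qed.

Lemma chamber_off w : off_walls root_normal (chamber_pt w).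
Proof.
move=> k /eqP; rewrite /root_normal dot_emb_pt (negbTE (root_ht_neq0 _)) //.
by apply: root_rho; case/pos_rootsP: (nth_pos_root k).
Qed.

Lemma ht_refl_differ i x : is_root x ->
  (Num.sg (ht (tits_refl s i *m x)) != Num.sg (ht x)) = (x == alpha i) || (x == - alpha i).
Proof.
have pos y : y \in pos_roots -> (Num.sg (ht (tits_refl s i *m y)) != Num.sg (ht y)) = (y == alpha i).
  move=> yP; have /pos_rootsP[ry hy] := yP; have [->|ny] := eqVneq y (alpha i).
    have /pos_rootsP[_ h] := simple_pos i.
    by rewrite tits_refl_self // htN sgrN (gtr0_sg h); lra.
  have /pos_rootsP[_ h] := refl_pos_roots yP ny.
  by rewrite !gtr0_sg ?eqxx.
have npos y : y \in pos_roots -> (y == - alpha i) = false.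
  move=> /pos_rootsP[_ h]; apply: contraTF h => /eqP->; rewrite htN oppr_gt0.
  by have /pos_rootsP[_ h'] := simple_pos i; rewrite ltNge ltW.
case/root_cases => xP; first by rewrite pos // npos // orbF.
have := pos _ xP; rewrite mulmxN !htN !sgrN eqr_opp => ->.
by rewrite -[x == alpha i]eqr_opp (npos _ xP) /= eqr_oppLR.
Qed.

(** Left multiplication of [w'] by [s i] only affects the roots that [w'] sends to [alpha i] or its
    opposite, which form one wall. Conversely, if a single wall separates, then [u = w * w'^-1]
    makes some [alpha i] negative and no other positive root, so [u * s i] keeps all simple roots
    positive and is trivial. *)
Lemma chamber_adjacent w w' : reflect
  (exists k, Num.sg (dot (root_normal k) (chamber_pt w)) != Num.sg (dot (root_normal k) (chamber_pt w')) /\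
     forall j, Num.sg (dot (root_normal j) (chamber_pt w)) != Num.sg (dot (root_normal j) (chamber_pt w')) -> j = k)
  (cayley_rel s w w').
Proof.
apply: (iffP existsP) => [[i /eqP->]|[k [kd kuniq]]].
  have dE j : (Num.sg (dot (root_normal j) (chamber_pt (s i * w')%g)) != Num.sg (dot (root_normal j) (chamber_pt w')))
      = (rho w' *m nth 0 pos_roots j == alpha i) || (rho w' *m nth 0 pos_roots j == - alpha i).
    rewrite /root_normal !dot_emb_pt rhoM -mulmxA rho_s ht_refl_differ //.
    by apply: root_rho; case/pos_rootsP: (nth_pos_root j).
  have rot j y : (rho w' *m nth 0 pos_roots j == y) = (nth 0 pos_roots j == rho w'^-1%g *m y).
    by apply/eqP/eqP => [<-|->]; rewrite ?rhoK ?rhoVK.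
  set b := rho w'^-1%g *m alpha i.
  have rb : is_root b by apply: root_rho; apply: root_simple.
  have nthI (j k : 'I_(size pos_roots)) : nth 0 pos_roots j = nth 0 pos_roots k -> j = k.
    by move=> E; apply/val_inj/eqP; rewrite /= -(nth_uniq 0 (ltn_ord j) (ltn_ord k) (undup_uniq _)) -/pos_roots E.
  have excl y : y \in pos_roots -> - y \in pos_roots -> False.
    by move=> /pos_rootsP[_ h] /pos_rootsP[_]; rewrite htN oppr_gt0 ltNge ltW.
  case: (root_cases rb) => bP; have [k hk] := pos_root_nth bP; exists k.
    rewrite dE !rot mulmxN -/b -hk eqxx; split=> // j.
    rewrite dE !rot mulmxN -/b hk => /orP[/eqP/nthI //|/eqP E].
    by case: (excl b bP); rewrite hk -E nth_pos_root.
  rewrite dE !rot mulmxN -/b -hk eqxx orbT; split=> // j.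
  rewrite dE !rot mulmxN -/b hk => /orP[/eqP E|/eqP/nthI //].
  by case: (excl (- b) bP); rewrite opprK -E nth_pos_root.
have neg_pos x : is_root x -> (0 < ht x) = false -> ht x < 0.
  by move=> /root_ht_neq0; rewrite neq_lt => /orP[//|->].
pose u := (w * w'^-1)%g.
(* A positive root that [u] makes negative comes from a separating wall, hence from the wall [k]. *)
have only x : is_root x -> 0 < ht x -> (0 < ht (rho u *m x)) = false ->
    rho w'^-1%g *m x = nth 0 pos_roots k \/ rho w'^-1%g *m x = - nth 0 pos_roots k.
  move=> rx hx nx; have hux := neg_pos _ (root_rho u rx) nx.
  have rx' := root_rho w'^-1%g rx.
  have d : Num.sg (ht (rho w *m (rho w'^-1%g *m x))) != Num.sg (ht (rho w' *m (rho w'^-1%g *m x))).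
    by rewrite rhoVK mulmxA -rhoM (ltr0_sg hux) (gtr0_sg hx); lra.
  case: (root_cases rx') => /pos_root_nth[j hj]; [left|right].
    by rewrite hj (kuniq j) // /root_normal !dot_emb_pt -hj.
  apply: oppr_inj; rewrite opprK hj (kuniq j) // /root_normal !dot_emb_pt -hj.
  by rewrite !mulmxN !htN !sgrN eqr_opp.
have [/existsP[i /negbTE ni]|/existsPn h] := boolP [exists i, ~~ (0 < ht (rho u *m alpha i))]; last first.
  have u1 : u = 1%g by apply: simple_pos_eq1 => i; have := h i; rewrite negbK.
  have ww' : w = w' by rewrite -(mulgKV w' w) -/u u1 mul1g.
  by rewrite ww' eqxx in kd.
have onlyi := only _ (root_simple i) (proj2 (elimT (pos_rootsP _) (simple_pos i))) ni.
exists i; apply/eqP; suff us : (u * s i = 1)%g.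
  have <- : u = s i by apply: (mulIg (s i)); rewrite us s2.
  by rewrite mulgKV.
apply: simple_pos_eq1 => b; have [->|nbi] := eqVneq b i.
  by rewrite rho_mul_s htN oppr_gt0 neg_pos //; apply: root_rho; apply: root_simple.
have nab : alpha b != alpha i.
  apply: contra nbi => /eqP/matrixP/(_ b 0) /eqP; rewrite !mxE !eqxx andbT /=.
  by case: (b == i) => //; rewrite oner_eq0.
have yP := refl_pos_roots (simple_pos b) nab; have /pos_rootsP[ry hy] := yP.
rewrite rhoM rho_s -mulmxA; apply: contraT => /negbTE ny.
have same (x y : 'cV[R]_p) : rho w'^-1%g *m x = rho w'^-1%g *m y -> x = y.
  by move=> E; rewrite -(rhoVK w' x) E rhoVK.
have yE : tits_refl s i *m alpha b = alpha i \/ tits_refl s i *m alpha b = - alpha i.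
  case: (only _ ry hy ny) onlyi => [Ey|Ey] [Ei|Ei].
  - by left; apply: same; rewrite Ey Ei.
  - by right; apply: same; rewrite mulmxN Ey Ei opprK.
  - by right; apply: same; rewrite mulmxN Ey Ei.
  - by left; apply: same; rewrite Ey Ei.
have /pos_rootsP[_ hb] := simple_pos b; have /pos_rootsP[_ hi] := simple_pos i.
case: yE => /(congr1 (mulmx (tits_refl s i))); rewrite refl_refl ?mulmxN tits_refl_self // ?opprK => E.
  by move: hb; rewrite E htN oppr_gt0 ltNge ltW.
by rewrite E eqxx in nab.
Qed.
End Roots.

Theorem coxeter_graph_tope (T : finType) (e : rel T) :
  coxeter_cayley_graph e -> tope_graph_of_reflection_arrangement e.
Proof.
move=> [gT [m [a [k [/coxeter_system_normal[p [s [s_inj s2 s_gen cay s_univ]]] [f [f_bij fP]]]]]]].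
have [rho [rho1 rhoM rho_s]] := tits_rep s_inj s2 s_univ.
pose pt := chamber_pt (p := p) (gT := gT); pose rn := root_normal (rho := rho).
exists _, _, rn; split; first exact: (root_arrangement s_inj s2 s_gen s_univ rho1 rhoM rho_s).
have off w : off_walls rn (pt w) by apply: (chamber_off s_inj s2 s_gen s_univ rho1 rhoM rho_s).
exists (fun t => pt (f t)); split; first by move=> t; apply: off.
have sc w y : same_component (off_walls rn) (pt w) y <-> same_signs rn (pt w) y.
  exact: same_componentP.
split.
  move=> x ox; have [w hw] := chamber_ex s_inj s2 s_gen s_univ rho1 rhoM rho_s ox.
  have [g fK gK] := f_bij; exists (g w); split; first by apply/sc; rewrite gK.
  move=> t /sc h; apply: (can_inj fK); rewrite gK; apply: (chamber_inj s_inj s2 s_gen s_univ rho1 rhoM rho_s).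
  by move=> i; rewrite hw h.
move=> t t'; rewrite -fP cay.
have sp i : separates (rn i) (same_component (off_walls rn) (pt (f t)))
   (same_component (off_walls rn) (pt (f t'))) <->
   Num.sg (dot (rn i) (pt (f t))) != Num.sg (dot (rn i) (pt (f t'))) by apply: separatesP.
split=> [/(chamber_adjacent s_inj s2 s_gen s_univ rho1 rhoM rho_s)[i [hi hu]]|[i [/sp hi hu]]].
  by exists i; split=> [|j]; [apply/sp|move=> /sp/hu].
by apply/(chamber_adjacent s_inj s2 s_gen s_univ rho1 rhoM rho_s); exists i; split=> // j /sp/hu.
Qed.

Theorem theorem8 (T : finType) (e : rel T) (He : simple_graph e) :
  (mirror_graph e <-> coxeter_cayley_graph e) /\
  (coxeter_cayley_graph e <-> tope_graph_of_reflection_arrangement e).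
Proof.
have mc := mirror_graph_coxeter He.
have ct := @coxeter_graph_tope T e.
have tm := @tope_graph_mirror T e.
by split; split; [exact: mc|move/ct/tm|exact: ct|move/tm/mc].
Qed.
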